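(* Let $f:\mathbb{R}^n\to\mathbb{R}$ be twice continuously differentiable with $L$-Lipschitz gradient, and let $x^*$ be a strict saddle point of $f$. If $\{x_k\}_{k\ge0}$ is generated by the PBCD method with step size $0<\alpha<\frac1L$ from an initial point $x_0$ distributed according to $\nu$, then $$\mathbb{P}_\nu\left[\lim_{k\to\infty}x_k=x^*\right]=0.$$
   Context: $\|\nabla f(x)-\nabla f(y)\|\le L\|x-y\|$ for all $x,y$, with $L>0$. The variable is partitioned as $x=(x(1),\dots,x(p))$, $x(t)\in\mathbb{R}^{n_t}$, $\sum_t n_t=n$. PBCD (proximal block coordinate descent) method: given $x_k$, set $x_k^0=x_k$ and for $s=1,\dots,p$ let $x_k^s(s)$ be the (unique) minimizer over $u\in\mathbb{R}^{n_s}$ of $f(x_k^{s-1}(1),\dots,x_k^{s-1}(s-1),u,x_k^{s-1}(s+1),\dots,x_k^{s-1}(p))+\frac{1}{2\alpha}\|u-x_k^{s-1}(s)\|_2^2$, and $x_k^s(t)=x_k^{s-1}(t)$ for $t\ne s$; then $x_{k+1}=x_k^p$. A strict saddle is a point $x^*$ with $\nabla f(x^* )=0$ and $\lambda_{\min}(\nabla^2 f(x^* ))<0$. $\nu$ is a probability measure on $\mathbb{R}^n$ absolutely continuous with respect to Lebesgue measure. *)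

(* Defs.v *)
From HB Require Import structures.
From mathcomp Require Import all_boot all_order all_algebra.
From mathcomp Require Import all_classical all_reals all_analysis.
Set Implicit Arguments. Unset Strict Implicit. Unset Printing Implicit Defensive.
Import Order.TTheory GRing.Theory Num.Theory numFieldNormedType.Exports.
Local Open Scope classical_set_scope.
Local Open Scope ring_scope.

Section defs.
Variables (R : realType) (n : nat).
Notation V := 'rV[R]_n.

Definition ebasis (i : 'I_n) : V := delta_mx 0 i.

Definition partial (i : 'I_n) (f : V -> R) : V -> R :=
  fun x => derive f x (ebasis i).

Definition grad (f : V -> R) (x : V) : V := \row_i partial i f x.
Definition hessian (f : V -> R) (x : V) : 'M[R]_n :=
  \matrix_(i, j) partial j (partial i f) x.

Definition C2 (f : V -> R) : Prop :=
  continuous f /\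
  (forall i x, derivable f x (ebasis i)) /\
  (forall i, continuous (partial i f)) /\
  (forall i j x, derivable (partial i f) x (ebasis j)) /\
  (forall i j, continuous (partial j (partial i f))).

Definition enorm (v : V) : R := Num.sqrt (\sum_i v 0 i ^+ 2).

Definition grad_lipschitz (f : V -> R) (L : R) : Prop :=
  forall x y, enorm (grad f x - grad f y) <= L * enorm (x - y).

Definition strict_saddle (f : V -> R) (xs : V) : Prop :=
  grad f xs = 0 /\ exists lam : R, eigenvalue (hessian f xs) lam /\ lam < 0.

(* Contiguous partition of coordinates into p blocks of sizes nt t:
   coordinate i belongs to block s iff
   n_1 + ... + n_{s-1} <= i < n_1 + ... + n_s  (0-indexed blocks). *)
Definition in_block (p : nat) (nt : 'I_p -> nat) (s : 'I_p) (i : 'I_n) : bool :=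
  ((\sum_(t < p | (t < s)%N) nt t <= i)%N && (i < \sum_(t < p | (t <= s)%N) nt t)%N).

(* The proximal block-s update of x: the minimizer, over points y agreeing
   with x outside block s, of f y + 1/(2 alpha) ||y(s) - x(s)||^2
   (= f y + 1/(2 alpha) ||y - x||^2 since y - x vanishes outside block s). *)
Definition block_argmin (f : V -> R) (alpha : R) (p : nat) (nt : 'I_p -> nat)
    (s : 'I_p) (x : V) : set V :=
  [set y : V | (forall i, ~~ in_block nt s i -> y 0 i = x 0 i) /\
     forall z : V, (forall i, ~~ in_block nt s i -> z 0 i = x 0 i) ->
       f y + (2 * alpha)^-1 * enorm (y - x) ^+ 2 <=
       f z + (2 * alpha)^-1 * enorm (z - x) ^+ 2].

Definition block_step f alpha p (nt : 'I_p -> nat) s (x : V) : V :=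
  xget 0 (block_argmin f alpha nt s x).

Definition pbcd_sweep f alpha p (nt : 'I_p -> nat) (x : V) : V :=
  foldl (fun y s => block_step f alpha nt s y) x (enum 'I_p).

Definition pbcd f alpha p (nt : 'I_p -> nat) (k : nat) (x0 : V) : V :=
  iter k (pbcd_sweep f alpha nt) x0.

End defs.

(* identify a point of R^n given as an n-tuple (the measurable-space model
   of R^n, with the product = Borel sigma-algebra) with a row vector *)
Definition tuple_to_row (R : realType) (n : nat) (t : n.-tuple R) : 'rV[R]_n :=
  \row_i tnth t i.

Definition box (R : realType) (n : nat) (a b : 'I_n -> R) : set (n.-tuple R) :=
  [set t | forall i, a i <= tnth t i <= b i].
Definition box_vol (R : realType) (n : nat) (a b : 'I_n -> R) : R :=
  \prod_i (b i - a i).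

Definition lebesgue_null (R : realType) (n : nat) (A : set (n.-tuple R)) : Prop :=
  forall eps : R, 0 < eps -> exists a b : nat -> 'I_n -> R,
    (forall k i, a k i <= b k i) /\
    A `<=` \bigcup_k box (a k) (b k) /\
    forall N, \sum_(k < N) box_vol (a k) (b k) <= eps.

Definition abs_cont_lebesgue (R : realType) (n : nat)
    (nu : set (n.-tuple R) -> \bar R) : Prop :=
  forall A : set (n.-tuple R), measurable A -> lebesgue_null A -> nu A = 0%E.

(* Main.v *)
Require Import Defs.
From HB Require Import structures.
From mathcomp Require Import all_boot all_order all_algebra.
From mathcomp Require Import all_classical all_reals all_analysis.
From mathcomp Require Import ring lra.
Import Order.TTheory GRing.Theory Num.Theory numFieldNormedType.Exports.
Local Open Scope classical_set_scope.
Local Open Scope ring_scope.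
Set Implicit Arguments. Unset Strict Implicit. Unset Printing Implicit Defensive.

(** Let [H] be the Hessian at the saddle and [q v = v H v^T]. The stationarity condition
    [y = x - alpha P_s (grad f y)] of a block step makes it Lipschitz with a Lipschitz
    inverse. Comparing two orbits near the saddle, with difference [v], a sweep lowers
    [q v] by a multiple of the squared displacement up to a small error. As [H] is
    symmetric, [|q v| <= K |v H|^2], hence for small [tau] the form
    [Q v = q v + tau^2 |v|^2] strictly decreases along every sweep starting in the cone
    [Q v <= 0]. Two orbits that tend to the saddle have [Q v -> 0], so their difference
    is never in that cone, which is nonempty since [H] has a negative eigenvalue. The
    points whose orbits stay close and converge thus form a Lipschitz graph over a
    hyperplane, covered by few small balls; such covers pull back through the iterates
    of the sweep, and a countable union exhausts all convergent orbits. No stable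
    manifold is constructed. *)

(** * Euclidean inner product and norm on row vectors *)

Section euclidean.
Context {R : realType} {n : nat}.
Implicit Types (u v w x y : 'rV[R]_n) (A : 'M[R]_n).

Definition dotv u v : R := \sum_i u 0 i * v 0 i.

Lemma dotvC u v : dotv u v = dotv v u.
Proof. by apply: eq_bigr => i _; rewrite mulrC. Qed.

Lemma dotvDl u v w : dotv (u + v) w = dotv u w + dotv v w.
Proof. by rewrite /dotv -big_split; apply: eq_bigr => i _; rewrite mxE mulrDl. Qed.

Lemma dotvZl a u w : dotv (a *: u) w = a * dotv u w.
Proof. by rewrite /dotv mulr_sumr; apply: eq_bigr => i _; rewrite mxE mulrA. Qed.

Lemma dotvNl u w : dotv (- u) w = - dotv u w.
Proof. by rewrite -scaleN1r dotvZl mulN1r. Qed.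

Lemma dotvBl u v w : dotv (u - v) w = dotv u w - dotv v w.
Proof. by rewrite dotvDl dotvNl. Qed.

Lemma dotvDr u v w : dotv u (v + w) = dotv u v + dotv u w.
Proof. by rewrite dotvC dotvDl !(dotvC u). Qed.

Lemma dotvZr a u w : dotv u (a *: w) = a * dotv u w.
Proof. by rewrite dotvC dotvZl dotvC. Qed.

Lemma dotvNr u w : dotv u (- w) = - dotv u w.
Proof. by rewrite dotvC dotvNl dotvC. Qed.

Lemma dotvBr u v w : dotv u (v - w) = dotv u v - dotv u w.
Proof. by rewrite dotvDr dotvNr. Qed.

Lemma dotvE u v : dotv u v = (u *m v^T) 0 0.
Proof. by rewrite mxE; apply: eq_bigr => i _; rewrite mxE. Qed.

Lemma dotv_mulmx A u v : dotv (u *m A) v = dotv u (v *m A^T).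
Proof. by rewrite !dotvE trmx_mul trmxK mulmxA. Qed.

Lemma dotv_ge0 u : 0 <= dotv u u.
Proof. by apply: sumr_ge0 => i _; rewrite -expr2 sqr_ge0. Qed.

Lemma enorm_ge0 u : 0 <= enorm u.
Proof. exact: sqrtr_ge0. Qed.

Lemma enorm_sq u : enorm u ^+ 2 = dotv u u.
Proof.
rewrite sqr_sqrtr; first by apply: eq_bigr => i _; rewrite expr2.
by apply: sumr_ge0 => i _; rewrite sqr_ge0.
Qed.

Lemma enorm0 : enorm (0 : 'rV[R]_n) = 0.
Proof.
apply/eqP; rewrite -sqrf_eq0 enorm_sq; apply/eqP.
by apply: big1 => i _; rewrite mxE mul0r.
Qed.

Lemma coord_le_enorm u i : `|u 0 i| <= enorm u.
Proof.
rewrite -sqrtr_sqr; apply: ler_wsqrtr.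
by rewrite (bigD1 i) //= lerDl sumr_ge0 // => j _; rewrite sqr_ge0.
Qed.

Lemma enorm_eq0 u : enorm u = 0 -> u = 0.
Proof.
move=> u0; apply/rowP => i; rewrite mxE; apply/eqP.
by rewrite -normr_le0 -u0 coord_le_enorm.
Qed.

Lemma enorm_gt0 u : u != 0 -> 0 < enorm u.
Proof.
move=> u0; rewrite lt_neqAle enorm_ge0 andbT eq_sym.
by apply: contra_neq u0 => /enorm_eq0.
Qed.

(** Cauchy-Schwarz: for [a = enorm u] and [b = enorm v], the squared length of [b *: u - a *: v] is
    [2ab(ab - dotv u v)]. *)
Lemma dotv_le_enorm u v : dotv u v <= enorm u * enorm v.
Proof.
have [->|u0] := eqVneq u 0.
  by rewrite enorm0 mul0r /dotv big1 // => i _; rewrite mxE mul0r.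
have [->|v0] := eqVneq v 0.
  by rewrite enorm0 mulr0 /dotv big1 // => i _; rewrite mxE mulr0.
have a0 := enorm_gt0 u0; have b0 := enorm_gt0 v0.
set a := enorm u in a0 *; set b := enorm v in b0 *.
have := dotv_ge0 (b *: u - a *: v).
have -> : dotv (b *: u - a *: v) (b *: u - a *: v) = 2 * (a * b) * (a * b - dotv u v).
  by rewrite !(dotvBl, dotvBr, dotvZl, dotvZr) (dotvC v u) -!enorm_sq -/a -/b; ring.
by rewrite pmulr_rge0 ?subr_ge0 // !mulr_gt0.
Qed.

Lemma enormN u : enorm (- u) = enorm u.
Proof. by congr Num.sqrt; apply: eq_bigr => i _; rewrite mxE sqrrN. Qed.

Lemma enorm_distC u v : enorm (u - v) = enorm (v - u).
Proof. by rewrite -enormN opprB. Qed.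

Lemma dotv_abs_le u v : `|dotv u v| <= enorm u * enorm v.
Proof. by rewrite ler_norml dotv_le_enorm andbT lerNl -dotvNl -(enormN u) dotv_le_enorm. Qed.

Lemma enormD u v : enorm (u + v) <= enorm u + enorm v.
Proof.
rewrite -(@ler_pXn2r _ 2) ?nnegrE ?addr_ge0 ?enorm_ge0 //.
rewrite enorm_sq dotvDl !dotvDr sqrrD -!enorm_sq (dotvC v u).
by have := dotv_le_enorm u v; lra.
Qed.

Lemma enormB u v : enorm (u - v) <= enorm u + enorm v.
Proof. by rewrite -(enormN v) enormD. Qed.

Lemma enormZ a u : enorm (a *: u) = `|a| * enorm u.
Proof.
rewrite /enorm; under eq_bigr do rewrite mxE exprMn.
by rewrite -mulr_sumr sqrtrM ?sqr_ge0 // sqrtr_sqr.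
Qed.

Lemma ler_enorm_coord u v : (forall i, `|u 0 i| <= `|v 0 i|) -> enorm u <= enorm v.
Proof.
move=> uv; apply: ler_wsqrtr; apply: ler_sum => i _.
by rewrite -(real_normK (num_real (u 0 i))) -(real_normK (num_real (v 0 i)))
  ler_pXn2r ?nnegrE.
Qed.

Lemma enorm_le_sum u : enorm u <= \sum_i `|u 0 i|.
Proof.
have s0 : 0 <= \sum_i `|u 0 i| by apply: sumr_ge0.
rewrite -(@ler_pXn2r _ 2) ?nnegrE ?enorm_ge0 // enorm_sq expr2 mulr_suml.
apply: ler_sum => i _; rewrite -expr2 -(real_normK (num_real _)) expr2.
by rewrite ler_wpM2l // (bigD1 i) //= lerDl sumr_ge0.
Qed.

Lemma enorm_le_const u c : (forall i, `|u 0 i| <= c) -> enorm u <= n%:R * c.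
Proof.
move=> uc; apply: le_trans (enorm_le_sum u) _.
by apply: le_trans (ler_sum _ (fun i _ => uc i)) _; rewrite sumr_const card_ord mulr_natl.
Qed.

Lemma enorm_mulmx_bound A : exists2 K : R, 0 <= K & forall u, enorm (u *m A) <= K * enorm u.
Proof.
exists (\sum_j \sum_i `|A i j|); first by do 2!(apply: sumr_ge0 => ? _).
move=> u; apply: le_trans (enorm_le_sum _) _; rewrite mulr_suml.
apply: ler_sum => j _; rewrite mxE mulr_suml.
apply: le_trans (ler_norm_sum _ _ _) _; apply: ler_sum => i _.
by rewrite normrM mulrC ler_wpM2l // coord_le_enorm.
Qed.

(* A pseudo-inverse [P] of [A] turns [u A u^T] into [(u A) P (u A)^T]. *)
Lemma symmetric_form_le_sq_enorm A : A^T = A ->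
  exists2 K : R, 0 <= K & forall u, `|dotv (u *m A) u| <= K * enorm (u *m A) ^+ 2.
Proof.
move=> As; have [K K0 hK] := enorm_mulmx_bound (pinvmx A).
exists K => // u.
have -> : dotv (u *m A) u = dotv (u *m A *m pinvmx A) (u *m A).
  have uA : u *m A = u *m A^T by rewrite As.
  by rewrite [X in _ = dotv _ X]uA -dotv_mulmx mulmxKpV // submxMl.
apply: le_trans (dotv_abs_le _ _) _.
by rewrite expr2 mulrA ler_wpM2r ?enorm_ge0.
Qed.

Lemma mx_norm_le_enorm u : `|u| <= enorm u.
Proof. by rewrite [leLHS]mx_normrE; apply: bigmax_le => [|[i j] _]; rewrite ?enorm_ge0 //= ord1 coord_le_enorm. Qed.

Lemma coord_le_mx_norm u i : `|u 0 i| <= `|u|.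
Proof. by rewrite [leRHS]mx_normrE; apply: (le_bigmax _ (fun ij => `|u ij.1 ij.2|) (0, i)). Qed.

Lemma enorm_le_mx_norm u : enorm u <= n%:R * `|u|.
Proof. by apply: enorm_le_const => i; exact: coord_le_mx_norm. Qed.

End euclidean.

(** * Derivatives along lines and mean value estimates *)

Section calculus.
Context {R : realType} {n : nat}.
Implicit Types (x y z v : 'rV[R]_n) (g : 'rV[R]_n -> R).

Lemma is_derive_line g x v (t : R) : derivable g (x + t *: v) v ->
  is_derive t 1 (fun s => g (x + s *: v)) (derive g (x + t *: v) v).
Proof.
move=> dg.
have E : (fun h : R => h^-1 *: (((fun s => g (x + s *: v)) \o shift t) (h *: 1)
    - g (x + t *: v))) =
  (fun h : R => h^-1 *: ((g \o shift (x + t *: v)) (h *: v) - g (x + t *: v))).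
  apply/funext => h /=; congr (_ *: (g _ - _)).
  by rewrite [h *: 1]mulr1 scalerDl addrCA addrA.
by split; [rewrite /derivable E | rewrite /derive E].
Qed.

(** Mean value theorem on the segment between [0] and [d], whatever the sign of [d]. *)
Lemma mvt_affine_le (phi dphi : R -> R) (d a eps : R) :
  (forall t : R, is_derive t 1 phi (dphi t)) ->
  (forall t, `|t| <= `|d| -> `|dphi t - a| <= eps) ->
  `|phi d - phi 0 - a * d| <= eps * `|d|.
Proof.
move=> dp hb.
have cont (A : set R) : {within A, continuous phi}.
  apply: continuous_subspaceT => t; apply: differentiable_continuous.
  by apply/derivable1_diffP; have [] := dp t.
have [d0|d0] := leP 0 d.
  have [c cI E] := MVT_segment d0 (fun t _ => dp t) (cont _).
  move: E; rewrite subr0 => ->; rewrite -mulrBl normrM ler_wpM2r // hb //.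
  by rewrite !ger0_norm ?(itvP cI).
have [c cI E] := MVT_segment (ltW d0) (fun t _ => dp t) (cont _).
move: E; rewrite sub0r => E.
have -> : phi d - phi 0 = dphi c * d by rewrite -[LHS]opprB E mulrN opprK.
rewrite -mulrBl normrM ler_wpM2r // hb //.
by rewrite !ler0_norm ?lerN2 ?(itvP cI) // ltW.
Qed.

Let mix x y (k : nat) : 'rV[R]_n := \row_j (if (j < k)%N then x 0 j else y 0 j).

(* One coordinate is moved at a time, so that only partial derivatives occur. *)
Lemma increment_partials g (a : 'rV[R]_n) x y (eps : R) :
  (forall i z, derivable g z (ebasis R i)) ->
  (forall i z, enorm (z - y) <= enorm (x - y) -> `|partial i g z - a 0 i| <= eps) ->
  `|g x - g y - dotv a (x - y)| <= eps * \sum_i `|(x - y) 0 i|.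
Proof.
move=> dg hb.
have -> : g x - g y = \sum_(k < n) (g (mix x y k.+1) - g (mix x y k)).
  rewrite -(big_mkord xpredT (fun k => g (mix x y k.+1) - g (mix x y k))).
  rewrite telescope_sumr //; congr (g _ - g _); apply/rowP => j.
    by rewrite mxE ltn_ord.
  by rewrite mxE ltn0.
rewrite /dotv -sumrB mulr_sumr; apply: le_trans (ler_norm_sum _ _ _) _.
apply: ler_sum => k _.
have mixS : mix x y k.+1 = mix x y k + (x - y) 0 k *: ebasis R k.
  apply/rowP => j; rewrite !mxE eqxx /= ltnS leq_eqVlt.
  have [->|jk] := eqVneq j k; first by rewrite eqxx /= ltnn mulr1 addrC subrK.
  by rewrite (inj_eq val_inj) (negbTE jk) mulr0 addr0.
have := @mvt_affine_le (fun t => g (mix x y k + t *: ebasis R k))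
  (fun t => partial k g (mix x y k + t *: ebasis R k)) ((x - y) 0 k) (a 0 k) eps
  (fun t => is_derive_line (dg k _)).
rewrite mixS scale0r addr0; apply => t td; apply: hb.
apply: ler_enorm_coord => j; rewrite !mxE eqxx /=.
have [->|jk] := eqVneq j k.
  by rewrite ltnn mulr1 addrAC subrr add0r; move: td; rewrite !mxE.
by rewrite mulr0 addr0; case: ifP => // _; rewrite subrr normr0.
Qed.

(** Turns a second-order error bound into a derivative; this yields derivatives in arbitrary
    directions from partial derivatives alone. *)
Lemma is_derive_quadratic (phi : R -> R) (t c K : R) :
  (forall h, `|phi (t + h) - phi t - c * h| <= K * h ^+ 2) -> is_derive t 1 phi c.
Proof.
move=> hb.
have cv : (fun h : R => h^-1 *: ((phi \o shift t) (h *: 1) - phi t)) @ 0^' --> c.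
  apply/cvgrPdist_le => e e0; near=> h.
  have h0 : h != 0 by near: h; exact: nbhs_dnbhs_neq.
  have hK : `|h| * (`|K| + 1) <= e.
    rewrite -ler_pdivlMr ?ltr_wpDl //; near: h.
    apply: dnbhs0_le; rewrite divr_gt0 // ltr_wpDl //.
  rewrite /= [h *: 1]mulr1 (addrC h t) [_ *: _]mulrC.
  have -> : c - (phi (t + h) - phi t) / h = - ((phi (t + h) - phi t - c * h) / h).
    by field.
  rewrite normrN normf_div ler_pdivrMr ?normr_gt0 //; apply: le_trans (hb h) _.
  apply: le_trans (_ : (`|h| * (`|K| + 1)) * `|h| <= _); last by rewrite ler_wpM2r.
  rewrite -(real_normK (num_real h)) expr2 mulrA ler_wpM2r // mulrC ler_wpM2l //.
  by rewrite (le_trans (ler_norm _)) // lerDl.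
split; first by apply/cvg_ex; exists c.
exact: cvg_lim cv.
Unshelve. all: by end_near. Qed.

Section smooth_gradient.
Variables (f : 'rV[R]_n -> R) (L : R).
Hypothesis df : forall i z, derivable f z (ebasis R i).
Hypothesis L0 : 0 <= L.
Hypothesis lipf : grad_lipschitz f L.

(** Over a displacement [h *: v] the gradient varies by at most [L * enorm (h *: v)], so the error
    in [increment_partials] is quadratic in [h]. *)
Lemma is_derive_line_grad x v (t : R) :
  is_derive t 1 (fun s => f (x + s *: v)) (dotv (grad f (x + t *: v)) v).
Proof.
pose K := L * enorm v * \sum_i `|v 0 i|.
apply: (@is_derive_quadratic _ _ _ K) => h.
have -> : x + (t + h) *: v = x + t *: v + h *: v by rewrite scalerDl addrA.
set y := x + t *: v.
have := @increment_partials f (grad f y) (y + h *: v) y (L * enorm (h *: v)) df.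
rewrite (addrC y) addrK dotvZr (mulrC h) => /(_ _) hf.
have -> : K * h ^+ 2 = L * enorm (h *: v) * \sum_i `|(h *: v) 0 i|.
  under eq_bigr do rewrite mxE normrM.
  rewrite -mulr_sumr enormZ -(real_normK (num_real h)) /K; ring.
apply: hf => i z zy.
have := coord_le_enorm (grad f z - grad f y) i; rewrite !mxE => /le_trans; apply.
apply: le_trans (lipf z y) _; by rewrite ler_wpM2l.
Qed.

Lemma descent_lemma x v :
  f x + dotv (grad f x) v - L / 2 * enorm v ^+ 2 <= f (x + v).
Proof.
pose c := dotv (grad f x) v.
(* The added quadratic makes the derivative of [psi] nonnegative for [t >= 0], by the Lipschitz
   bound; the claim is [psi 0 <= psi 1]. *)
pose psi (t : R) := f (x + t *: v) + (L / 2 * enorm v ^+ 2 * t ^+ 2 - c * t).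
pose dpsi (t : R) := dotv (grad f (x + t *: v)) v + (L * enorm v ^+ 2 * t - c).
have dp (t : R) : is_derive t 1 psi (dpsi t).
  have h1 := is_derive_line_grad x v t.
  rewrite /psi.
  apply: is_derive_eq.
  by rewrite /dpsi /GRing.scale /=; congr (_ + _); field.
have cont : {within `[0, 1], continuous psi}.
  apply: continuous_subspaceT => t; apply: differentiable_continuous.
  by apply/derivable1_diffP; have [] := dp t.
have [t tI E] := MVT_segment ler01 (fun t _ => dp t) cont.
have t0 : 0 <= t by rewrite (itvP tI).
have : 0 <= psi 1 - psi 0.
  rewrite E subr0 mulr1 /dpsi /c addrCA -dotvBl.
  have := dotv_abs_le (grad f (x + t *: v) - grad f x) v; rewrite ler_norml => /andP[h _].
  have : enorm (grad f (x + t *: v) - grad f x) * enorm v <= L * enorm v ^+ 2 * t.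
    apply: le_trans (ler_wpM2r (enorm_ge0 _) (lipf _ _)) _.
    by rewrite (addrC x) addrK enormZ ger0_norm // le_eqVlt; apply/orP; left; apply/eqP; ring.
  by move: h; lra.
rewrite /psi scale1r scale0r addr0 /c; lra.
Qed.

End smooth_gradient.

(** * Second-order behaviour of [f] at a point *)

Section second_order.
Variables (f : 'rV[R]_n -> R) (xs : 'rV[R]_n).
Hypothesis C2f : C2 f.
Let H := hessian f xs.

(** Strict differentiability of the gradient: by continuity the second partials are uniformly close
    to [H] on a ball, and [increment_partials] is applied to each first partial. *)
Lemma gradient_strict_derivative (eps : R) : 0 < eps -> exists2 r : R, 0 < r &
  forall x y, enorm (x - xs) <= r -> enorm (y - xs) <= r ->
    enorm (grad f x - grad f y - (x - y) *m H^T) <= eps * enorm (x - y).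
Proof.
case: C2f => _ [_ [_ [d2f c2f]]] e0.
(* One factor [n] comes from summing the increments in each row, the other from passing from
   coordinates to the norm; the [1] keeps the denominator positive. *)
pose e' := eps / (n%:R * n%:R + 1).
have N0 : 0 < n%:R * n%:R + 1 :> R by rewrite ltr_wpDl // mulr_ge0.
have e'0 : 0 < e' by rewrite divr_gt0.
have : \forall z \near xs, forall i j, `|partial j (partial i f) z - H i j| <= e'.
  have FF : Filter (nbhs xs) := nbhs_filter xs.
  refine (@filter_forall _ 'I_n (fun i z => forall j,
    `|partial j (partial i f) z - H i j| <= e') _ FF _) => i.
  refine (@filter_forall _ 'I_n (fun j z =>
    `|partial j (partial i f) z - H i j| <= e') _ FF _) => j.
  have /cvgrPdist_le/(_ e' e'0) := c2f i j xs.
  by apply: filterS => z; rewrite distrC mxE.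
(* The intermediate points satisfy [enorm (z - y) <= enorm (x - y) <= r / 2], hence lie within
   [3r / 4] of [xs]. *)
move=> /nbhs_ballP[r /= r0 hr]; exists (r / 4); first by rewrite divr_gt0.
move=> x y xr yr.
have hi i : `|(grad f x - grad f y - (x - y) *m H^T) 0 i| <= e' * (n%:R * enorm (x - y)).
  have := @increment_partials (partial i f) (row i H) x y e' (d2f i) _.
  have -> : partial i f x - partial i f y - dotv (row i H) (x - y) =
      (grad f x - grad f y - (x - y) *m H^T) 0 i.
    rewrite !mxE; congr (_ - _); apply: eq_bigr => j _; rewrite !mxE mulrC //.
  move=> /(_ _) h; apply: le_trans (h _) _; last first.
    rewrite ler_wpM2l ?(ltW e'0) //.
    apply: le_trans (ler_sum _ (fun j _ => coord_le_enorm _ j)) _.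
    by rewrite sumr_const card_ord mulr_natl.
  move=> j z zy; rewrite !mxE -/(partial j (partial i f) xs).
  suff : ball xs r z by move=> /hr /(_ i j); rewrite mxE.
  rewrite -ball_normE /ball_ /= ; apply: le_lt_trans (mx_norm_le_enorm _) _.
  rewrite enorm_distC.
  have -> : z - xs = (z - y) + (y - xs) by rewrite addrA subrK.
  apply: le_lt_trans (enormD _ _) _.
  have : enorm (x - y) <= enorm (x - xs) + enorm (y - xs).
    by rewrite (_ : x - y = (x - xs) - (y - xs)) ?enormB // opprB addrA subrK.
  by move: r0 xr yr zy; lra.
apply: le_trans (enorm_le_const hi) _.
have -> : n%:R * (e' * (n%:R * enorm (x - y))) = e' * (n%:R * n%:R) * enorm (x - y).
  by ring.
rewrite ler_wpM2r ?enorm_ge0 //.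
by rewrite /e' mulrAC ler_pdivrMr // ler_wpM2l ?(ltW e0) // lerDl.
Qed.

Lemma enorm_ebasis i : enorm (ebasis R i : 'rV[R]_n) = 1.
Proof.
rewrite /enorm (bigD1 i) //= big1 ?addr0 => [|j ji]; rewrite mxE !eqxx /=.
  by rewrite expr1n sqrtr1.
by rewrite (negbTE ji) expr0n.
Qed.

(** The second difference is the increment over [[0, s]] of [f (u t) - f (w t)], whose derivative, a
    difference of [partial i f] over [s *: ebasis R j], is close to [s * H i j]. *)
Lemma second_difference i j (eps : R) : 0 < eps -> exists2 r : R, 0 < r &
  forall s, 0 < s -> s <= r ->
    `|f (xs + s *: ebasis R j + s *: ebasis R i) - f (xs + s *: ebasis R i)
      - (f (xs + s *: ebasis R j) - f xs) - s * H i j * s| <= eps * s * s.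
Proof.
move=> e0; have [r r0 hr] := gradient_strict_derivative e0.
case: C2f => _ [df _].
exists (r / 2); first by rewrite divr_gt0.
move=> s s0 sr.
pose u (t : R) := xs + s *: ebasis R j + t *: ebasis R i.
pose w (t : R) := xs + t *: ebasis R i.
have hd (t : R) : is_derive t 1 (fun t => f (u t) - f (w t))
    (partial i f (u t) - partial i f (w t)).
  have h1 := is_derive_line (df i (u t)); have h2 := is_derive_line (df i (w t)).
  exact: is_deriveB.
have := @mvt_affine_le (fun t => f (u t) - f (w t)) _ s (s * H i j) (eps * s) hd.
rewrite /u /w !scale0r !addr0 [`|s|]gtr0_norm //; apply => t ts.
have wr : enorm (w t - xs) <= r.
  by rewrite /w (addrC xs) addrK enormZ enorm_ebasis mulr1; move: ts sr r0; lra.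
have ur : enorm (u t - xs) <= r.
  rewrite /u -[xs + _ + _]addrA (addrC xs) addrK; apply: le_trans (enormD _ _) _.
  rewrite !enormZ !enorm_ebasis !mulr1 (gtr0_norm s0); move: ts sr r0; lra.
have := hr _ _ ur wr.
have E : u t - w t = s *: ebasis R j.
  by rewrite /u /w [xs + _ + _]addrAC [X in X - _]addrC addrK.
rewrite E enormZ enorm_ebasis mulr1 (gtr0_norm s0); apply: le_trans.
apply: le_trans (coord_le_enorm _ i).
rewrite -scalemxAl -/(ebasis R j) -rowE !mxE //.
Qed.

(* Both [H i j] and [H j i] are limits of the same second difference quotient. *)
Lemma hessian_sym : H^T = H.
Proof.
apply/matrixP => i j; rewrite mxE; apply/eqP; rewrite -subr_eq0 -normr_le0.
apply/ler_addgt0Pr => e e0; rewrite add0r.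
have e20 : 0 < e / 2 by rewrite divr_gt0.
have [r1 r10 h1] := second_difference i j e20.
have [r2 r20 h2] := second_difference j i e20.
pose s := Num.min r1 r2.
have s0 : 0 < s by rewrite lt_min r10.
have sr1 : s <= r1 by rewrite ge_min lexx.
have sr2 : s <= r2 by rewrite ge_min lexx orbT.
have := h1 s s0 sr1; have := h2 s s0 sr2.
have -> : xs + s *: ebasis R i + s *: ebasis R j = xs + s *: ebasis R j + s *: ebasis R i.
  by rewrite addrAC.
set A := f (xs + _ + _); set B := f (xs + _); set C := f (xs + _).
rewrite !ler_norml => /andP[a1 a2] /andP[a3 a4].
have ss : 0 < s * s by rewrite mulr_gt0.
have : `|(H j i - H i j) * (s * s)| <= e * (s * s).
  by rewrite ler_norml; apply/andP; split; lra.
by rewrite normrM (gtr0_norm ss) ler_pM2r // ler_norml.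
Qed.

(** [v *m H] is the limit of difference quotients of the gradient, each bounded by [L * enorm v]. *)
Lemma hessian_le_lipschitz (L : R) v : grad_lipschitz f L ->
  enorm (v *m H) <= L * enorm v.
Proof.
move=> lipf; apply/ler_addgt0Pr => e e0.
have v1 : 0 < enorm v + 1 by rewrite ltr_wpDl ?enorm_ge0.
have [r r0 hr] := gradient_strict_derivative (divr_gt0 e0 v1).
pose t := r / (enorm v + 1).
have t0 : 0 < t by rewrite divr_gt0.
have tv : xs + t *: v - xs = t *: v by rewrite (addrC xs) addrK.
have xr : enorm (xs + t *: v - xs) <= r.
  by rewrite tv enormZ gtr0_norm // /t mulrAC ler_pdivrMr // ler_wpM2l ?(ltW r0) // lerDl.
have xx : enorm (xs - xs) <= r by rewrite subrr enorm0 ltW.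
have := hr _ _ xr xx; have := lipf (xs + t *: v) xs.
rewrite tv hessian_sym -scalemxAl !enormZ (gtr0_norm t0).
set G := _ - grad f xs => h1 h2.
have h3 : t * enorm (v *m H) <= enorm G + enorm (G - t *: (v *m H)).
  rewrite -[X in X * _](gtr0_norm t0) -enormZ.
  by have := enormB G (G - t *: (v *m H)); rewrite subKr.
rewrite -(ler_pM2l t0) mulrDr; apply: le_trans h3 _; apply: lerD.
  by apply: le_trans h1 _; rewrite mulrCA.
apply: le_trans h2 _; rewrite mulrCA ler_wpM2l ?(ltW t0) //.
by rewrite mulrAC ler_pdivrMr // ler_wpM2l ?(ltW e0) // lerDl.
Qed.

End second_order.
End calculus.

(** * Proximal block steps: existence, stationarity, Lipschitz bounds in both directions *)

Section block_steps.
Context {R : realType} {n : nat}.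
Implicit Types (u v w x y z : 'rV[R]_n).

Lemma enorm_lipschitz_continuous (W : normedModType R) (g : 'rV[R]_n -> W) (K : R) :
  (forall x y, `|g x - g y| <= K * enorm (x - y)) -> continuous g.
Proof.
move=> hg x; apply/(@cvgrPdist_le _ _ _ (nbhs x) (nbhs_filter x)) => e e0.
have K0 : 0 < (`|K| + 1) * (n%:R + 1) by rewrite mulr_gt0 // ltr_wpDl.
apply/nbhs_ballP; exists (e / ((`|K| + 1) * (n%:R + 1))); first exact: divr_gt0.
move=> y; rewrite -ball_normE /ball_ /= ltr_pdivlMr // mulrC => /ltW; apply: le_trans.
apply: le_trans (hg _ _) _.
apply: le_trans (_ : (`|K| + 1) * enorm (x - y) <= _).
  by rewrite ler_wpM2r ?enorm_ge0 // (le_trans (ler_norm _)) // lerDl.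
rewrite -mulrA ler_wpM2l ?addr_ge0 //.
by apply: le_trans (enorm_le_mx_norm _) _; rewrite ler_wpM2r // lerDl.
Qed.

Lemma enorm_dist_le x y : `|enorm x - enorm y| <= enorm (x - y).
Proof.
rewrite ler_norml.
have := enormD (x - y) y; have := enormD (y - x) x; rewrite !subrK (enorm_distC y).
by move=> h1 h2; apply/andP; split; lra.
Qed.

Lemma enorm_continuous : continuous (@enorm R n).
Proof.
by apply: (@enorm_lipschitz_continuous _ _ 1) => x y; rewrite mul1r enorm_dist_le.
Qed.

Definition keep_coords (D : pred 'I_n) v : 'rV[R]_n := \row_i (if D i then v 0 i else 0).

Lemma enorm_keep_coords D v : enorm (keep_coords D v) <= enorm v.
Proof. by apply: ler_enorm_coord => i; rewrite mxE; case: ifP; rewrite ?normr0. Qed.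

Lemma keep_coordsB D u v : keep_coords D (u - v) = keep_coords D u - keep_coords D v.
Proof. by apply/rowP => i; rewrite !mxE; case: ifP; rewrite ?subr0. Qed.

Variables (f : 'rV[R]_n -> R) (L alpha : R) (p : nat) (nt : 'I_p -> nat).
Hypothesis C2f : C2 f.
Hypothesis L0 : 0 < L.
Hypothesis lipf : grad_lipschitz f L.
Hypothesis a0 : 0 < alpha.
Hypothesis aL : alpha < L^-1.

Let aL1 : alpha * L < 1.
Proof. by rewrite -ltr_pdivlMr // div1r. Qed.

Local Notation P s := (keep_coords (@in_block n p nt s)).
Local Notation step := (block_step f alpha nt).

(** As [alpha < L^-1], the descent lemma makes the objective at least [f x] outside the ball of
    radius [rho], so a minimizer over this compact ball is global. *)
Lemma block_argmin_nonempty s x : block_argmin f alpha nt s x !=set0.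
Proof.
have [cf [df _]] := C2f.
pose c := (2 * alpha)^-1 - L / 2.
have c0 : 0 < c.
  have La : L < alpha^-1 by rewrite -[ltLHS]invrK ltf_pV2 ?posrE ?invr_gt0.
  by rewrite /c invfM; lra.
pose rho := enorm (grad f x) / c.
have rho0 : 0 <= rho by rewrite divr_ge0 ?enorm_ge0 // ltW.
pose phi z := f z + (2 * alpha)^-1 * enorm (z - x) ^+ 2.
(* Composing with the projection [P s] removes the constraint: every admissible [z] is
   [x + P s (z - x)]. *)
pose psi d := phi (x + P s d).
pose A := [set d : 'rV[R]_n | enorm d <= rho].
have cA : compact A.
  apply: bounded_closed_compact.
    exists rho; split; first exact: num_real.
    move=> M rM d dA; apply: le_trans (mx_norm_le_enorm _) _.
    exact: le_trans dA (ltW rM).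
  apply: (@closed_comp _ _ (@enorm R n) [set r : R | r <= rho]); last exact: closed_le.
  by move=> d _; exact: enorm_continuous.
have cpsi : continuous psi.
  have c1 : continuous (fun d => x + P s d).
    apply: (@enorm_lipschitz_continuous _ _ 1) => d d'.
    rewrite opprD addrACA subrr add0r -keep_coordsB mul1r.
    by apply: le_trans (mx_norm_le_enorm _) _; exact: enorm_keep_coords.
  have c2 : continuous (fun d => enorm (x + P s d - x)).
    apply: (@enorm_lipschitz_continuous _ _ 1) => d d'.
    rewrite mul1r !(addrC x) !addrK; apply: le_trans (enorm_dist_le _ _) _.
    by rewrite -keep_coordsB enorm_keep_coords.
  have c3 : continuous (f \o (fun d => x + P s d)).
    by move=> d; apply: continuous_comp; [exact: c1|exact: cf].
  move=> d; apply: (@cvgD _ _ _ (nbhs d) (nbhs_filter d)); first exact: c3.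
  apply: (@cvgM _ _ (nbhs d) (nbhs_filter d)); first exact: cvg_cst.
  exact: (@cvgM _ _ (nbhs d) (nbhs_filter d) _ _ _ _ (c2 d) (c2 d)).
have A0 : A 0 by rewrite /A /= enorm0.
have [|d dA dmin] := EVT_min_rV (ex_intro _ _ A0) cA (f := psi).
  exact: continuous_subspaceT.
exists (x + P s d); split => [i iB|z hz].
  by rewrite !mxE (negbTE iB) addr0.
rewrite -/(phi _) -/(phi _) -/(psi d).
have zE : z = x + P s (z - x).
  apply/rowP => i; rewrite !mxE; case: ifPn => iB; first by rewrite addrC subrK.
  by rewrite addr0 hz.
have [zr|zr] := leP (enorm (z - x)) rho.
  by rewrite zE; apply: dmin; rewrite inE.
have h0 : psi d <= f x.
  have := dmin 0; rewrite inE => /(_ A0) /le_trans; apply.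
  rewrite /psi /phi.
  have -> : P s 0 = 0 by apply/rowP => i; rewrite !mxE; case: ifP.
  by rewrite addr0 subrr enorm0 expr0n mulr0 addr0.
apply: le_trans h0 _.
have := descent_lemma df (ltW L0) lipf x (z - x).
have := dotv_abs_le (grad f x) (z - x); rewrite ler_norml => /andP[h1 _].
rewrite (addrC x) subrK /phi => h2.
have h3 : enorm (grad f x) * enorm (z - x) <= c * enorm (z - x) ^+ 2.
  rewrite expr2 mulrA ler_wpM2r ?enorm_ge0 //.
  by rewrite -ler_pdivrMl // mulrC ltW.
move: h1 h2 h3; rewrite /c; lra.
Qed.

Lemma block_step_argmin s x : block_argmin f alpha nt s x (step s x).
Proof. by apply: xgetPex; exact: block_argmin_nonempty. Qed.

Lemma block_argmin_stationary s x y i : block_argmin f alpha nt s x y ->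
  in_block nt s i -> (y - x) 0 i = - alpha * grad f y 0 i.
Proof.
case=> yx ymin iB; have [cf [df _]] := C2f.
(* The objective along coordinate [i], with the penalty expanded as a polynomial in [t]; its minimum
   at [t = 0] forces a zero derivative. *)
pose phi (t : R) := f (y + t *: ebasis R i) +
  (2 * alpha)^-1 * (enorm (y - x) ^+ 2 + 2 * (y - x) 0 i * t + t ^+ 2).
have phiE t : phi t = f (y + t *: ebasis R i) +
    (2 * alpha)^-1 * enorm (y + t *: ebasis R i - x) ^+ 2.
  rewrite /phi; congr (_ + _ * _); rewrite [y + _ - x]addrAC.
  move: (y - x) => d; rewrite [RHS]enorm_sq dotvDl !dotvDr (dotvC _ d) !dotvZr dotvZl -!enorm_sq enorm_ebasis.
  have -> : dotv d (ebasis R i) = d 0 i.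
    rewrite /dotv (bigD1 i) //= big1 => [|j ji]; last first.
      by rewrite [ebasis R i 0 j]mxE (negbTE ji) andbF mulr0.
    by rewrite [ebasis R i 0 i]mxE !eqxx mulr1 addr0.
  by ring.
pose dphi (t : R) := partial i f (y + t *: ebasis R i) +
  (2 * alpha)^-1 * (2 * (y - x) 0 i + 2 * t).
have dp (t : R) : is_derive t 1 phi (dphi t).
  have h1 := is_derive_line (df i (y + t *: ebasis R i)).
  rewrite /phi; apply: is_derive_eq.
  by rewrite /dphi /GRing.scale /=; congr (_ + _ * _); ring.
have N11 : -1 <= 1 :> R by lra.
have I0 : 0 \in `](-1 : R), 1[%R by rewrite in_itv /=; apply/andP; split; lra.
have := @derive1_at_min _ phi _ _ 0 N11 (fun t _ => @ex_derive _ _ _ _ _ _ _ (dp t)) I0.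
case => [t _|_ ].
  rewrite !phiE scale0r addr0; apply: ymin => j jB.
  rewrite !mxE eqxx /= yx //; case: (eqVneq j i) => [ji|_]; last by rewrite mulr0 addr0.
  by rewrite ji iB in jB.
have := @derive_val _ _ _ _ _ _ _ (dp 0) => -> .
rewrite /dphi scale0r addr0 mulr0 addr0 !mxE => E.
have an0 : alpha != 0 by rewrite gt_eqF.
have -> : y 0 i - x 0 i = 2 * alpha * ((2 * alpha)^-1 * (2 * (y 0 i - x 0 i))) / 2.
  by field.
by move/eqP: E; rewrite addr_eq0 => /eqP ->; field.
Qed.

(** The step is an implicit gradient step: the gradient is taken at the new point. *)
Lemma block_stepE s x : step s x - x = - alpha *: P s (grad f (step s x)).
Proof.
have am := block_step_argmin s x; apply/rowP => i; rewrite [RHS]mxE [P s _ 0 i]mxE.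
case: ifPn => iB; first by rewrite (block_argmin_stationary am iB).
by case: am => h _; rewrite !mxE h // subrr mulr0.
Qed.

Lemma block_stepB s x y : step s x - step s y =
  x - y - alpha *: P s (grad f (step s x) - grad f (step s y)).
Proof.
have E z : alpha *: P s (grad f (step s z)) = z - step s z.
  by rewrite -[RHS]opprB block_stepE scaleNr opprK.
by rewrite keep_coordsB scalerBr !E; apply/rowP => i; rewrite !mxE; ring.
Qed.

Let Pgrad_le s x y :
  enorm (alpha *: P s (grad f (step s x) - grad f (step s y))) <=
  alpha * L * enorm (step s x - step s y).
Proof.
rewrite enormZ gtr0_norm // -mulrA ler_wpM2l ?(ltW a0) //.
exact: le_trans (enorm_keep_coords _ _) (lipf _ _).
Qed.

(** Subtracting the implicit equations at [x] and [y] leaves a gradient term of size at most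
    [alpha * L] times the new distance, absorbed on the left since [alpha * L < 1]. *)
Lemma block_step_lipschitz s x y :
  enorm (step s x - step s y) <= (1 - alpha * L)^-1 * enorm (x - y).
Proof.
rewrite ler_pdivlMl ?subr_gt0 // mulrBl mul1r lerBlDr.
rewrite [X in enorm X <= _]block_stepB; apply: le_trans (enormB _ _) _.
by rewrite lerD2l Pgrad_le.
Qed.

Lemma block_step_expansion s x y :
  enorm (x - y) <= (1 + alpha * L) * enorm (step s x - step s y).
Proof.
rewrite mulrDl mul1r.
have E : x - y = step s x - step s y + alpha *: P s (grad f (step s x) - grad f (step s y)).
  by rewrite block_stepB subrK.
by rewrite [X in enorm X <= _]E; apply: le_trans (enormD _ _) _; rewrite lerD2l Pgrad_le.
Qed.

End block_steps.

(** The block is the least [k] whose partial sum, block [k] included, exceeds [i]; minimality gives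
    the lower bound. *)
Lemma in_block_cover (n p : nat) (nt : 'I_p -> nat) (i : 'I_n) :
  (\sum_(t < p) nt t)%N = n -> exists s, in_block nt s i.
Proof.
move=> sn.
pose P k := (i < \sum_(t < p | (t <= k)%N) nt t)%N.
have full k : (p <= k.+1)%N -> (\sum_(t < p | (t <= k)%N) nt t)%N = n.
  move=> pk; rewrite -sn; apply: eq_bigl => t.
  by rewrite -ltnS (leq_trans (ltn_ord t)).
have exP : exists k, P k by exists p; rewrite /P full.
case: (ex_minnP exP) => k Pk kmin.
have kp : (k < p)%N.
  rewrite ltnNge; apply/negP => pk; case: k pk Pk kmin => [|k] pk Pk kmin.
    by move: Pk; rewrite /P big1 // => t; have := leq_trans (ltn_ord t) pk.
  by have := kmin k; rewrite /P full // ltn_ord ltnn => /(_ isT).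
exists (Ordinal kp); rewrite /in_block /=; apply/andP; split; last exact: Pk.
case: k {kp Pk} kmin => [|k] kmin; first by rewrite big1.
rewrite leqNgt; apply/negP => Pk; have := kmin k Pk.
by rewrite ltnn.
Qed.

(** * Decrease of the quadratic form along a sweep *)

Section cone.
Context {R : realType} {n : nat}.
Implicit Types (u v w x y z : 'rV[R]_n).

(* [a], [a'] are the lengths of the difference of two orbits before and after a sweep,
   [S] bounds its displacement, [q], [q'] are the values of the quadratic form and [N]
   is the length of its gradient. Inside the cone [q <= - tau^2 a^2] the bound
   [- q <= K N^2] gives [S >= const * tau * a], so the decrease [c S^2] beats the
   perturbations, which are [O(tau) S^2]. *)
Lemma cone_decrease (c C D K : R) : 0 < c -> 0 <= C -> 0 <= D -> 0 <= K ->
  exists2 tau0 : R, 0 < tau0 & forall tau : R, 0 < tau -> tau <= tau0 ->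
  exists eps eta : R, [/\ 0 < eps, 0 < eta &
    forall a a' S q q' N : R, 0 <= a -> 0 <= a' -> 0 <= S -> 0 <= N ->
      q' <= q - c * S ^+ 2 + 2 * eps * S * (a + S) ->
      a' <= a + S -> N <= D * (C * S + eps * (a + S)) -> - q <= K * N ^+ 2 ->
      q + tau ^+ 2 * a ^+ 2 <= 0 ->
      q' + tau ^+ 2 * a' ^+ 2 <= q + tau ^+ 2 * a ^+ 2 - eta * a ^+ 2].
Proof.
move=> c0 C0 D0 K0.
pose B := D * (K + 1) + 1.
have B0 : 0 < B by rewrite ltr_wpDl // mulr_ge0 // addr_ge0.
pose M := 2 * B * (C + 1).
have M0 : 0 < M by rewrite mulr_gt0 ?mulr_gt0 // ltr_wpDl.
have M3 : 0 < 2 * (4 * M + 3) by lra.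
(* The perturbations will add up to at most [tau * (4 * M + 3) * S ^+ 2]; this choice keeps them
   below half of the decrease [c * S ^+ 2]. *)
exists (Num.min 1 (c / (2 * (4 * M + 3)))); first by rewrite lt_min ltr01 divr_gt0.
move=> tau t0; rewrite le_min ler_pdivlMr // => /andP[t1 tc].
(* The bound [tau ^+ 2] makes the term [eps * a * S] of order [tau * S ^+ 2]; the bound
   [tau / (2 * B)] lets [B * eps * a] be absorbed by half of [tau * a]. *)
pose eps := Num.min (tau ^+ 2) (tau / (2 * B)).
have eps0 : 0 < eps by rewrite lt_min exprn_gt0 // divr_gt0 // mulr_gt0.
have eps1 : eps <= tau ^+ 2 by rewrite ge_min lexx.
have eps2 : B * eps <= tau / 2.
  have : eps <= tau / (2 * B) by rewrite ge_min lexx orbT.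
  by rewrite ler_pdivlMr ?mulr_gt0 //; lra.
have tt : tau ^+ 2 <= tau by rewrite expr2 -[leRHS]mulr1 ler_wpM2l // ltW.
(* The other half of the decrease, [c / 2 * S ^+ 2], is bounded below through [tau * a <= M * S]. *)
exists eps, (c / 2 * (tau / M) ^+ 2); split => //.
  by rewrite mulr_gt0 ?divr_gt0 // exprn_gt0 // divr_gt0.
move=> a a' S q q' N a0 a'0 S0 N0 hq ha hN hqN hQ.
set X := C * S + eps * (a + S) in hN.
have X0 : 0 <= X by rewrite addr_ge0 ?mulr_ge0 ?addr_ge0 // ltW.
have BX0 : 0 <= B * X := mulr_ge0 (ltW B0) X0.
have K10 : 0 <= K + 1 by rewrite addr_ge0.
have DX0 : 0 <= D * X := mulr_ge0 D0 X0.
(* In the cone [tau ^+ 2 * a ^+ 2 <= - q <= K * N ^+ 2]; bounding [K] by [(K + 1) ^+ 2] allows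
   taking roots of squares. *)
have h1 : tau * a <= B * X.
  rewrite -(@ler_pXn2r _ 2) ?nnegrE // ?mulr_ge0 ?(ltW t0) //.
  apply: le_trans (_ : K * N ^+ 2 <= _); first by rewrite exprMn; lra.
  apply: le_trans (_ : (K + 1) ^+ 2 * (D * X) ^+ 2 <= _).
    apply: ler_pM; rewrite ?exprn_ge0 //.
      by rewrite sqrrD1; have := sqr_ge0 K; lra.
    by rewrite ler_pXn2r ?nnegrE.
  rewrite -exprMn ler_pXn2r ?nnegrE // ?(mulr_ge0 K10) //.
  by rewrite mulrA ler_wpM2r // /B [leLHS]mulrC lerDl.
have h2 : tau * a <= M * S.
  have e1 : eps <= 1 by apply: le_trans eps1 _; apply: le_trans tt _.
  have hBS : B * eps * S <= B * S.
    by rewrite -mulrA ler_wpM2l ?(ltW B0) // -[leRHS]mul1r ler_wpM2r.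
  have hBa : B * eps * a <= tau / 2 * a by rewrite ler_wpM2r.
  by move: h1; rewrite /X /M; lra.
have h3 : tau ^+ 2 * a * S <= tau * M * (S * S).
  rewrite (_ : _ * S = (tau * S) * (tau * a)); last by ring.
  rewrite (_ : tau * M * _ = (tau * S) * (M * S)); last by ring.
  by rewrite ler_wpM2l // mulr_ge0 // ltW.
have h4 : eps * a * S <= tau * M * (S * S).
  by apply: le_trans h3; rewrite ler_wpM2r // ler_wpM2r.
have SS : 0 <= S * S by rewrite mulr_ge0.
have h5 : eps * (S * S) <= tau * (S * S).
  by rewrite ler_wpM2r // (le_trans eps1).
have h6 : tau ^+ 2 * (S * S) <= tau * (S * S) by rewrite ler_wpM2r.
have h7 : tau * (2 * (4 * M + 3)) * (S * S) <= c * (S * S) by rewrite ler_wpM2r.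
have h8 : c / 2 * (tau / M) ^+ 2 * a ^+ 2 <= c / 2 * (S * S).
  rewrite -mulrA ler_wpM2l ?divr_ge0 ?(ltW c0) // -exprMn -expr2.
  rewrite ler_pXn2r ?nnegrE // ?(mulr_ge0 (divr_ge0 (ltW t0) (ltW M0)) a0) //.
  by rewrite mulrAC ler_pdivrMr // [leRHS]mulrC.
have h9 : tau ^+ 2 * a' ^+ 2 <= tau ^+ 2 * (a + S) ^+ 2.
  by rewrite ler_wpM2l ?exprn_ge0 ?(ltW t0) // ler_pXn2r ?nnegrE ?addr_ge0.
have E : 2 * eps * S * (a + S) + tau ^+ 2 * (a + S) ^+ 2 =
  tau ^+ 2 * a ^+ 2 + 2 * (eps * a * S) + 2 * (eps * (S * S)) +
  2 * (tau ^+ 2 * a * S) + tau ^+ 2 * (S * S) by ring.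
by move: hq; rewrite [S ^+ 2]expr2; lra.
Qed.

Variables (f : 'rV[R]_n -> R) (L alpha : R) (p : nat) (nt : 'I_p -> nat).
Hypothesis C2f : C2 f.
Hypothesis L0 : 0 < L.
Hypothesis lipf : grad_lipschitz f L.
Hypothesis a0 : 0 < alpha.
Hypothesis aL : alpha < L^-1.
Variable xs : 'rV[R]_n.
Hypothesis grad0 : grad f xs = 0.

Local Notation step := (block_step f alpha nt).
Let H := hessian f xs.
Let q v := dotv (v *m H) v.
Let HT : H^T = H := hessian_sym xs C2f.

Let Hsym u v : dotv (u *m H) v = dotv (v *m H) u.
Proof. by rewrite dotv_mulmx HT dotvC. Qed.

Let qB w u : q (w - u) = q w - 2 * dotv (w *m H) u + q u.
Proof. by rewrite /q mulmxBl !dotvBl !dotvBr (Hsym u w); ring. Qed.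

Let qL v : `|q v| <= L * enorm v ^+ 2.
Proof.
apply: le_trans (dotv_abs_le _ _) _.
by rewrite expr2 mulrA ler_wpM2r ?enorm_ge0 // hessian_le_lipschitz.
Qed.

Let La : L < alpha^-1.
Proof. by rewrite -[ltLHS]invrK ltf_pV2 ?posrE ?invr_gt0. Qed.

(** As the gradient vanishes at [xs], the implicit equation bounds the displacement by
    [alpha * L < 1] times itself. *)
Lemma block_step_saddle s : step s xs = xs.
Proof.
have := block_stepE nt C2f L0 lipf a0 aL s xs.
set y := step s xs => Ey.
have h : enorm (y - xs) <= alpha * L * enorm (y - xs).
  rewrite {1}Ey enormZ normrN gtr0_norm // -mulrA ler_wpM2l ?(ltW a0) //.
  apply: le_trans (enorm_keep_coords _ _) _.
  by have := lipf y xs; rewrite grad0 subr0.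
apply/eqP; rewrite -subr_eq0; apply/eqP/enorm_eq0/eqP.
rewrite eq_le enorm_ge0 andbT.
have aL1 : 0 < 1 - alpha * L by rewrite subr_gt0 -ltr_pdivlMr // div1r.
by rewrite -(pmulr_rle0 _ aL1) mulrBl mul1r subr_le0.
Qed.

Section near_saddle.
Variables (eps r : R).
Hypothesis eps0 : 0 < eps.
Hypothesis hr : forall x y, enorm (x - xs) <= r -> enorm (y - xs) <= r ->
    enorm (grad f x - grad f y - (x - y) *m H^T) <= eps * enorm (x - y).

(** With [e = w - v], [q w = q v + 2 * dotv (w *m H) e - q e]. Up to [eps], [w *m H] is the gradient
    difference [g], and stationarity gives [dotv g e = - alpha^-1 * enorm e ^+ 2]. The term [q e]
    costs at most [L * enorm e ^+ 2], half of the gain. On block [s], [g] is [- alpha^-1 *: e],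
    which bounds [v *m H] there. *)
Lemma block_step_difference s x y :
  let v := x - y in let w := step s x - step s y in
  enorm (step s x - xs) <= r -> enorm (step s y - xs) <= r ->
  q w <= q v - alpha^-1 * enorm (w - v) ^+ 2 + 2 * eps * enorm (w - v) * enorm w /\
  forall i, in_block nt s i ->
    `|(v *m H) 0 i| <= (alpha^-1 + L) * enorm (w - v) + eps * enorm w.
Proof.
move=> v w xr yr.
have := hr xr yr; rewrite HT -/w; set g := _ - grad f (step s y); set rr := g - _ => rle.
pose e := w - v; rewrite -/e.
have an0 : alpha != 0 by rewrite gt_eqF.
have eE : e = - (alpha *: keep_coords (in_block nt s) g).
  by rewrite /e /w (block_stepB nt C2f L0 lipf a0 aL) -/g addrAC subrr add0r.
have ei i : in_block nt s i -> g 0 i = - (alpha^-1 * e 0 i).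
  by move=> iB; rewrite eE !mxE iB; field.
have dg : dotv g e = - (alpha^-1 * enorm e ^+ 2).
  rewrite enorm_sq /dotv mulr_sumr -sumrN; apply: eq_bigr => i _.
  have [iB|iB] := boolP (in_block nt s i); first by rewrite ei // mulNr mulrA.
  have -> : e 0 i = 0 by rewrite eE !mxE (negbTE iB) mulr0 oppr0.
  by rewrite !mulr0 oppr0.
have gE : w *m H = g - rr by rewrite /rr subKr.
have vE : v = w - e by rewrite /e subKr.
have qv : q v = q w - 2 * dotv (w *m H) e + q e.
  by rewrite {1}vE qB.
have rre : `|dotv rr e| <= eps * enorm w * enorm e.
  by apply: le_trans (dotv_abs_le _ _) _; rewrite ler_wpM2r ?enorm_ge0.
split.
  have : dotv (w *m H) e = - (alpha^-1 * enorm e ^+ 2) - dotv rr e.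
    by rewrite gE dotvBl dg.
  move: qv rre (qL e); rewrite !ler_norml => qv /andP[r1 _] /andP[r2 _] hw.
  have : L * enorm e ^+ 2 <= alpha^-1 * enorm e ^+ 2.
    by rewrite ler_wpM2r ?exprn_ge0 ?enorm_ge0 // ltW.
  by move: qv; rewrite hw; lra.
move=> i iB; rewrite vE mulmxBl gE.
have -> : (g - rr - e *m H) 0 i = - (alpha^-1 * e 0 i) - rr 0 i - (e *m H) 0 i.
  by rewrite -(ei i iB) !mxE.
have t1 := coord_le_enorm e i; have t2 := coord_le_enorm rr i.
have t3 := coord_le_enorm (e *m H) i; have t4 := hessian_le_lipschitz xs C2f e lipf.
have ai : 0 < alpha^-1 by rewrite invr_gt0.
have t5 : `|alpha^-1 * e 0 i| <= alpha^-1 * enorm e.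
  by rewrite normrM gtr0_norm // ler_wpM2l // ltW.
apply: le_trans (ler_normB _ _) _; apply: le_trans (lerD (ler_normB _ _) (lexx _)) _.
by rewrite normrN -/H in t4 *; move: rle; lra.
Qed.

Let run l x := foldl (fun y s => step s y) x l.
Let K := (1 - alpha * L)^-1.

Let K1 : 1 <= K.
Proof.
have aL0 : 0 < alpha * L by rewrite mulr_gt0.
have aL1 : 0 < 1 - alpha * L by rewrite subr_gt0 -ltr_pdivlMr // div1r.
by rewrite /K -[leLHS]invr1 lef_pV2 ?posrE //; lra.
Qed.

(** Induction on the blocks, [S] being the sum of the displacements of the single steps. The powers
    of [K] keep all intermediate points within [r] of [xs], where the gradient is nearly linear. *)
Lemma sweep_difference l x y :
  K ^+ size l * enorm (x - xs) <= r -> K ^+ size l * enorm (y - xs) <= r ->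
  let v := x - y in let w := run l x - run l y in
  exists S : R, [/\ 0 <= S, enorm (w - v) <= S,
    q w <= q v - alpha^-1 / 2 ^+ size l * S ^+ 2 + 2 * eps * S * (enorm v + S) &
    forall s i, s \in l -> in_block nt s i ->
      `|(v *m H) 0 i| <= (alpha^-1 + L) * S + eps * (enorm v + S)].
Proof.
elim: l x y => [|s l IH] x y xr yr v w.
  exists 0; split => //; first by rewrite subrr enorm0.
  by rewrite expr0n !mulr0 mul0r subr0 addr0.
have Kp : 0 <= K ^+ size l by rewrite exprn_ge0 // (le_trans ler01).
have near z : K ^+ size (s :: l) * enorm (z - xs) <= r ->
    K ^+ size l * enorm (step s z - xs) <= r.
  move=> zr; apply: le_trans zr; rewrite /= exprSr -mulrA ler_wpM2l //.
  rewrite -{1}(block_step_saddle s).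
  exact: (block_step_lipschitz nt C2f L0 lipf a0 aL).
have near1 z : K ^+ size (s :: l) * enorm (z - xs) <= r -> enorm (step s z - xs) <= r.
  move=> /near; apply: le_trans; rewrite -[leLHS]mul1r ler_wpM2r ?enorm_ge0 //.
  exact: exprn_ege1.
have [S1 [S10 wS1 q1 b1]] := IH _ _ (near x xr) (near y yr).
have [q2 b2] := block_step_difference (near1 x xr) (near1 y yr).
set v1 := step s x - step s y in wS1 q1 b1 q2 b2.
rewrite -/v in q2 b2.
have -> : w = run l (step s x) - run l (step s y) by [].
move: wS1 q1; set w' := _ - run l _ => wS1 q1.
set e := enorm (v1 - v) in q2 b2.
have e0 : 0 <= e := enorm_ge0 _.
have v1v : enorm v1 <= enorm v + e.
  by have := enormD v (v1 - v); rewrite (addrC v) subrK.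
have v0 := enorm_ge0 v; have v10 := enorm_ge0 v1.
have eS1 : 0 <= e * S1 by rewrite mulr_ge0.
exists (e + S1); split; first by rewrite addr_ge0.
- have -> : w' - v = (v1 - v) + (w' - v1) by rewrite [RHS]addrC addrA subrK.
  by apply: le_trans (enormD _ _) _; rewrite lerD2l.
- pose c := alpha^-1 / 2 ^+ size l.
  have c0 : 0 < c by rewrite divr_gt0 ?invr_gt0 // exprn_gt0.
  have cE : alpha^-1 / 2 ^+ size (s :: l) = c / 2 by rewrite /= exprSr invfM mulrA.
  have ca : c <= alpha^-1.
    rewrite ler_pdivrMr ?exprn_gt0 // ler_peMr ?invr_ge0 ?(ltW a0) //.
    by rewrite exprn_ege1 // ler1n.
  rewrite cE; rewrite -/c in q1.
  have h1 : c * e ^+ 2 <= alpha^-1 * e ^+ 2 by rewrite ler_wpM2r ?exprn_ge0.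
  (* This is [(e + S1) ^+ 2 <= 2 * (e ^+ 2 + S1 ^+ 2)], the source of one factor [1 / 2] per
     block. *)
  have h2 : 0 <= c * (S1 - e) ^+ 2 by rewrite mulr_ge0 ?sqr_ge0 // ltW.
  have h3 : eps * S1 * enorm v1 <= eps * S1 * (enorm v + e).
    by rewrite ler_wpM2l // mulr_ge0 // ltW.
  have h4 : eps * e * enorm v1 <= eps * e * (enorm v + e).
    by rewrite ler_wpM2l // mulr_ge0 // ltW.
  have h5 : 0 <= eps * (e * S1) by rewrite mulr_ge0 // ltW.
  move: q1 q2 h1 h2 h3 h4 h5; lra.
- have aL0 : 0 <= alpha^-1 + L by rewrite addr_ge0 ?invr_ge0 // ltW.
  have h1 : 0 <= (alpha^-1 + L) * S1 by rewrite mulr_ge0.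
  have h2 : eps * enorm v1 <= eps * (enorm v + e) by rewrite ler_wpM2l // ltW.
  have h3 : 0 <= eps * S1 by rewrite mulr_ge0 // ltW.
  move=> t i; rewrite in_cons => /predU1P[->|tl] iB.
    by have := b2 i iB; lra.
  have := b1 t i tl iB.
  (* Later blocks bound [v1 *m H]; returning to [v] costs [L] times the displacement [e] of the
     first step. *)
  have -> : (v *m H) 0 i = (v1 *m H) 0 i - ((v1 - v) *m H) 0 i.
    have E : v *m H = v1 *m H - (v1 - v) *m H by rewrite -mulmxBl subKr.
    by rewrite E mxE [X in _ + X = _]mxE.
  have t3 := coord_le_enorm ((v1 - v) *m H) i.
  have t4 := hessian_le_lipschitz xs C2f (v1 - v) lipf.
  have t5 : 0 <= alpha^-1 * e by rewrite mulr_ge0 // invr_ge0 ltW.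
  move=> t6; apply: le_trans (ler_normB _ _) _.
  by rewrite -/H -/e in t4 *; lra.
Qed.

End near_saddle.
End cone.

(** * Sets with finite covers of arbitrarily small volume *)

Section thin_sets.
Context {R : realType} {n : nat}.
Implicit Types (u v x y : 'rV[R]_n) (A : set 'rV[R]_n).

(** Essentially zero Jordan content. The common radius [h] lets a cover be transported by rescaling
    one number. *)
Definition thin A := forall eps : R, 0 < eps ->
  exists (M : nat) (c : nat -> 'rV[R]_n) (h : R), [/\ 0 <= h, M%:R * h ^+ n <= eps &
    forall x, A x -> exists2 k, (k < M)%N & enorm (x - c k) <= h].

Lemma thin_preimage (T : 'rV[R]_n -> 'rV[R]_n) (K : R) A : 0 < K ->
  (forall x y, enorm (x - y) <= K * enorm (T x - T y)) ->
  thin A -> thin (T @^-1` A).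
Proof.
move=> K0 hT tA eps e0.
have K2 : 0 < (2 * K) ^+ n by rewrite exprn_gt0 // mulr_gt0.
have [M [c [h [h0 hM hc]]]] := tA _ (divr_gt0 e0 K2).
(* The old centre may lie outside the range of [T], so any point mapped into the ball serves as new
   centre; two such images are [2 * h] apart at most. Balls missing the range get the irrelevant
   centre [0]. *)
exists M, (fun k => xget 0 [set x | enorm (T x - c k) <= h]), (2 * K * h); split.
- by rewrite mulr_ge0 // mulr_ge0 // ltW.
- by rewrite exprMn mulrCA mulrC -ler_pdivlMr.
move=> x /hc[k kM hk]; exists k => //.
set y := xget _ _.
have hy : [set z | enorm (T z - c k) <= h] y by apply: xgetPex; exists x.
apply: le_trans (hT _ _) _; rewrite (mulrC 2) -mulrA ler_wpM2l ?(ltW K0) //.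
have -> : T x - T y = (T x - c k) - (T y - c k) by rewrite opprB addrA subrK.
by apply: le_trans (enormB _ _) _; rewrite mulr_natl mulr2n; exact: lerD.
Qed.

(** A grid of [N ^ n.-1] cells of side [2 * B / N] in the chart gives as many balls of radius
    [C * (2 * B / N)], whose total [V / N] tends to [0]. *)
Lemma thin_chart (phi : 'rV[R]_n -> 'I_n.-1 -> R) (B C : R) A :
  (0 < n)%N -> 0 < B -> 0 <= C ->
  (forall x j, A x -> `|phi x j| < B) ->
  (forall x y (h : R), 0 <= h -> A x -> A y -> (forall j, `|phi x j - phi y j| <= h) ->
     enorm (x - y) <= C * h) ->
  thin A.
Proof.
move=> n0 B0 C0 phiB phiC eps e0.
pose V := (C * (2 * B)) ^+ n.
have V0 : 0 <= V by rewrite exprn_ge0 // !mulr_ge0 // ltW.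
pose N' := Num.truncn (V / eps); pose N := N'.+1.
have NV : V / eps < N%:R by rewrite truncnS_gt.
have N0 : 0 < N%:R :> R by rewrite ltr0n.
have B2 : 0 < 2 * B by rewrite mulr_gt0.
(* Chart coordinates in units of cells, in [[0, N)]; their integer parts index the cell. *)
pose pos x j := (phi x j + B) * N%:R / (2 * B).
pose idx x : {ffun 'I_n.-1 -> 'I_N} := [ffun j => inord (Num.truncn (pos x j))].
exists #|{ffun 'I_n.-1 -> 'I_N}|,
  (fun k => xget 0 [set x | A x /\ enum_rank (idx x) = k :> nat]),
  (C * (2 * B / N%:R)); split.
- by rewrite mulr_ge0 // divr_ge0 // ltW.
- rewrite card_ffun !card_ord mulrA exprMn -/V exprVn natrX.
  have -> : N%:R ^+ n.-1 * (V / N%:R ^+ n) = V / N%:R.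
    have -> : N%:R ^+ n = N%:R * N%:R ^+ n.-1 :> R by rewrite -exprS prednK.
    by field; rewrite expf_neq0 ?pnatr_eq0.
  by rewrite ler_pdivrMr // mulrC -ler_pdivrMr // ltW.
move=> x Ax; exists (enum_rank (idx x)); first exact: ltn_ord.
set y := xget _ _.
have [Ay yx] : [set z | A z /\ enum_rank (idx z) = enum_rank (idx x) :> nat] y.
  by apply: xgetPex; exists x.
apply: phiC => // [|j]; first by rewrite divr_ge0 // ltW.
have := congr1 (fun g : {ffun _} => g j) (enum_rank_inj (val_inj yx)); rewrite !ffunE => /(congr1 val) /=.
have pos0 z : A z -> 0 <= pos z j.
  move=> /(phiB z j); rewrite ltr_norml => /andP[h _].
  by rewrite divr_ge0 ?mulr_ge0 ?(ltW B2) //; lra.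
have posN z : A z -> (Num.truncn (pos z j) < N)%N.
  move=> Az; rewrite -(ltr_nat R); apply: le_lt_trans (_ : pos z j < _).
    by rewrite truncn_le pos0.
  rewrite /pos ltr_pdivrMr // mulrC ltr_pM2l //.
  by move: (phiB z j Az); rewrite ltr_norml => /andP[_]; lra.
rewrite !inordK ?posN // => E.
have := truncn_itv (pos0 _ Ax); have := truncn_itv (pos0 _ Ay); rewrite E.
set m := Num.truncn _ => /andP[y1 y2] /andP[x1 x2].
have : `|pos x j - pos y j| <= 1.
  by move: x2 y2; rewrite -natr1 => x2 y2; rewrite ler_norml; apply/andP; split; lra.
have -> : pos x j - pos y j = (phi x j - phi y j) * (N%:R / (2 * B)).
  by rewrite /pos; field; rewrite gt_eqF.
rewrite normrM (@gtr0_norm _ (_ / _)) ?divr_gt0 //.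
by rewrite -ler_pdivlMr ?divr_gt0 // invf_div mul1r.
Qed.

(* Writing [d = t v0 + u] with [u] in a coordinate hyperplane, nonnegativity of the
   form forces [|t| <= C |u|]: the set is a Lipschitz graph over that hyperplane. *)
Lemma cone_free_thin (S : 'M[R]_n) v0 (B : R) A : S^T = S ->
  dotv (v0 *m S) v0 < 0 -> (forall x, A x -> enorm x <= B) ->
  (forall x y, A x -> A y -> x != y -> 0 <= dotv ((x - y) *m S) (x - y)) ->
  thin A.
Proof.
move=> Ss v0neg AB Apos.
have [i0 v0i] : exists i, v0 0 i != 0.
  apply/existsP; rewrite -[X in is_true X]negbK negb_exists; apply/negP => /forallP z.
  have v00 : v0 = 0 by apply/rowP => i; rewrite mxE; apply/eqP; have := z i; rewrite negbK.
  by move: v0neg; rewrite v00 mul0mx /dotv big1 ?ltxx // => i _; rewrite mxE mul0r.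
pose w := (v0 0 i0)^-1 *: v0.
have wi : w 0 i0 = 1 by rewrite mxE mulVf.
pose Q d := dotv (d *m S) d.
have Qexp (t : R) (a b : 'rV[R]_n) :
    Q (t *: a + b) = t ^+ 2 * Q a + 2 * t * dotv (a *m S) b + Q b.
  rewrite /Q mulmxDl -scalemxAl !(dotvDl, dotvDr, dotvZl, dotvZr).
  have -> : dotv (b *m S) a = dotv (a *m S) b by rewrite dotv_mulmx Ss dotvC.
  by ring.
pose kap := - Q w.
have kap0 : 0 < kap.
  rewrite /kap /Q /w -scalemxAl dotvZl dotvZr mulrA oppr_gt0 pmulr_rlt0 //.
  by rewrite -expr2 exprn_even_gt0 //= invr_neq0.
have [K K0 hK] := enorm_mulmx_bound S.
pose pr (d : 'rV[R]_n) : 'rV[R]_n := d - d 0 i0 *: w.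
have pri d : pr d 0 i0 = 0 by rewrite mxE [X in _ + X]mxE [X in _ - X]mxE wi mulr1 subrr.
have prB d d' : pr (d - d') = pr d - pr d'.
  by apply/rowP => j; rewrite !mxE; ring.
(* If [0 <= Q d] and [enorm u <= |t|], the expansion of [Q (t *: w + u)] gives
   [kap * t ^+ 2 <= c * enorm u * |t|]. *)
pose c := 2 * (K * enorm w) + K.
have c0 : 0 <= c by rewrite addr_ge0 ?mulr_ge0 ?enorm_ge0.
have key d : 0 <= Q d -> `|d 0 i0| <= (c / kap + 1) * enorm (pr d).
  set t := d 0 i0; set u := pr d => Qd.
  have dE : d = t *: w + u by rewrite /u /pr -/t addrC subrK.
  have QE : Q d = t ^+ 2 * Q w + 2 * t * dotv (w *m S) u + Q u.
    by rewrite [in LHS]dE Qexp.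
  have u0 := enorm_ge0 u; have w0 := enorm_ge0 w; have t0 := normr_ge0 t.
  have b1 : `|dotv (w *m S) u| <= K * enorm w * enorm u.
    by apply: le_trans (dotv_abs_le _ _) _; rewrite ler_wpM2r.
  have b2 : Q u <= K * enorm u * enorm u.
    by apply: le_trans (dotv_le_enorm _ _) _; rewrite ler_wpM2r.
  have b3 : t * dotv (w *m S) u <= `|t| * (K * enorm w * enorm u).
    apply: le_trans (ler_norm _) _; rewrite normrM; exact: ler_wpM2l.
  rewrite leNgt; apply/negP => tu.
  have ck : 0 <= c / kap by rewrite divr_ge0 // ltW.
  have ut : enorm u <= `|t|.
    apply: le_trans (ltW tu); rewrite -[leLHS]mul1r ler_wpM2r //; lra.
  have tp : 0 < `|t|.
    by apply: le_lt_trans tu; rewrite mulr_ge0 // addr_ge0.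
  have b4 : K * enorm u * enorm u <= K * enorm u * `|t| by rewrite ler_wpM2l // mulr_ge0.
  have b5 : kap * `|t| ^+ 2 <= c * enorm u * `|t|.
    move: Qd; rewrite QE real_normK ?num_real // /kap /c; lra.
  have b6 : `|t| <= c / kap * enorm u.
    by rewrite mulrAC ler_pdivlMr // -(ler_pM2r tp); move: b5; rewrite expr2; lra.
  move: tu; rewrite ltNge => /negP; apply; apply: le_trans b6 _.
  by rewrite ler_wpM2r // lerDl.
have n0 : (0 < n)%N by apply: leq_ltn_trans (ltn_ord i0).
pose D := (c / kap + 1).
have D0 : 0 <= D by rewrite addr_ge0 // divr_ge0 // ltW.
(* The chart projects along [w] and reads the coordinates other than [i0]. *)
apply: (@thin_chart (fun x j => pr x 0 (lift i0 j))
  (`|B| * (1 + enorm w) + 1) ((1 + D * enorm w) * n%:R)) => //.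
- by rewrite ltr_wpDl // mulr_ge0 // addr_ge0 // enorm_ge0.
- by rewrite mulr_ge0 // addr_ge0 // mulr_ge0 // enorm_ge0.
- move=> x j Ax.
  have xB : enorm x <= `|B| by apply: le_trans (AB _ Ax) (ler_norm _).
  apply: le_lt_trans (coord_le_enorm _ _) _.
  apply: le_lt_trans (enormB _ _) _; rewrite enormZ.
  have : `|x 0 i0| * enorm w <= `|B| * enorm w.
    by rewrite ler_wpM2r ?enorm_ge0 // (le_trans (coord_le_enorm _ _)).
  by lra.
move=> x y h h0 Ax Ay hxy.
have [->|xy] := eqVneq x y.
  by rewrite subrr enorm0 !mulr_ge0 // addr_ge0 // mulr_ge0 // enorm_ge0.
have dpos := Apos _ _ Ax Ay xy; have := key _ dpos.
set d := x - y => kd.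
have pd : enorm (pr d) <= n%:R * h.
  apply: enorm_le_const => i; have [j ->|->] := unliftP i0 i; last by rewrite pri normr0.
  by have := hxy j; rewrite /d prB [X in _ -> `|X| <= _]mxE [X in _ -> `|_ + X| <= _]mxE.
have dE : d = d 0 i0 *: w + pr d by rewrite /pr addrC subrK.
rewrite dE; apply: le_trans (enormD _ _) _; rewrite enormZ.
rewrite -mulrA; apply: le_trans (_ : (1 + D * enorm w) * enorm (pr d) <= _); last first.
  by rewrite ler_wpM2l // addr_ge0 // mulr_ge0 // enorm_ge0.
have := ler_wpM2r (enorm_ge0 w) kd; rewrite -/D; lra.
Qed.

End thin_sets.

(** * Borel sets of row vectors are measurable in the tuple model *)

Section measurability.
Context {R : realType} {n : nat}.

Lemma rational_row_dense (x : 'rV[R]_n) (e : R) : 0 < e ->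
  exists q : 'rV[rat]_n, ball (map_mx ratr q : 'rV[R]_n) e x.
Proof.
move=> e0.
have /choice[q hq] (i : 'I_n) : exists q : rat, `|ratr q - x 0 i| < e.
  have xe : x 0 i - e < x 0 i + e by lra.
  have [q] := rat_in_itvoo xe; rewrite in_itv /= => /andP[h1 h2]; exists q.
  by rewrite ltr_norml; apply/andP; split; lra.
exists (\row_i q i); split => // i j.
by rewrite !mxE (ord1 i); exact: hq.
Qed.

Lemma measurable_ball_row (c : 'rV[R]_n) (e : R) : 0 < e ->
  measurable [set t : n.-tuple R | ball c e (tuple_to_row t)].
Proof.
move=> e0.
have -> : [set t : n.-tuple R | ball c e (tuple_to_row t)] =
    \bigcap_(i : 'I_n) ((fun t : n.-tuple R => tnth t i) @^-1` ball (c 0 i) e).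
  apply/seteqP; split => t.
    by case=> _ h i _; have := h 0 i; rewrite mxE.
  by move=> h; split => // i j; rewrite (ord1 i) mxE; exact: h.
apply: fin_bigcap_measurable => [|i _]; first exact: finite_finset.
rewrite -[X in measurable X]setTI; apply: measurable_tnth => //.
by rewrite ball_itv; exact: measurable_itv.
Qed.

(** An open set is the union of the balls with rational centre and radius [1 / (m + 1)] that it
    contains, enumerated by [pickle]. *)
Lemma measurable_open_row (U : set 'rV[R]_n) : open U ->
  measurable [set t : n.-tuple R | U (tuple_to_row t)].
Proof.
move=> oU.
pose G (qm : 'rV[rat]_n * nat) : set (n.-tuple R) :=
  if `[< ball (map_mx ratr qm.1 : 'rV[R]_n) qm.2.+1%:R^-1 `<=` U >]
  then [set t | ball (map_mx ratr qm.1 : 'rV[R]_n) qm.2.+1%:R^-1 (tuple_to_row t)]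
  else set0.
have -> : [set t : n.-tuple R | U (tuple_to_row t)] =
    \bigcup_k (if unpickle k is Some qm then G qm else set0).
  apply/seteqP; split => t /=.
    set x := tuple_to_row t => Ux.
    have /nbhs_ballP[r /= r0 hr] : nbhs x U by apply: open_nbhs_nbhs.
    pose m := Num.truncn (2 / r).
    have mr : m.+1%:R^-1 * 2 < r.
      by rewrite mulrC ltr_pdivrMr // mulrC -ltr_pdivrMr // truncnS_gt.
    have m0 : 0 < m.+1%:R^-1 :> R by rewrite invr_gt0.
    have [q hq] := rational_row_dense x m0.
    exists (pickle (q, m)) => //; rewrite pickleK /G ifT //=.
    apply/asboolP => z hz; apply: hr; apply: le_ball (ltW mr) _ _.
    rewrite mulr_natr mulr2n; apply: ball_triangle hz; exact: ball_sym.
  move=> [k _]; case: unpickle => [qm|//]; rewrite /G.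
  by case: asboolP => // h /h.
apply: bigcup_measurable => k _; case: unpickle => [qm|]; last exact: measurable0.
rewrite /G; case: ifP => _; last exact: measurable0.
by apply: measurable_ball_row; rewrite invr_gt0.
Qed.

Lemma measurable_enorm_le (g : 'rV[R]_n -> 'rV[R]_n) (K : R) (l : 'rV[R]_n) (e : R) :
  (forall x y, enorm (g x - g y) <= K * enorm (x - y)) ->
  measurable [set t : n.-tuple R | enorm (g (tuple_to_row t) - l) <= e].
Proof.
move=> gK.
have -> : [set t : n.-tuple R | enorm (g (tuple_to_row t) - l) <= e] =
    ~` [set t | [set x | e < enorm (g x - l)] (tuple_to_row t)].
  by apply/seteqP; split => t /=; rewrite leNgt => /negP.
apply: measurableC; apply: (@measurable_open_row [set x | e < enorm (g x - l)]).
apply: (@open_comp _ _ (fun x => enorm (g x - l)) [set r : R | e < r]); last exact: open_gt.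
move=> x _; apply: (@enorm_lipschitz_continuous _ _ _ _ K) => {}x y.
apply: le_trans (enorm_dist_le _ _) _.
by rewrite opprB addrA subrK.
Qed.

End measurability.

(** * From thin sets to Lebesgue null sets *)

Section null_sets.
Context {R : realType} {n : nat}.

Lemma thin_lebesgue_null (A : set 'rV[R]_n) : (0 < n)%N -> thin A ->
  lebesgue_null [set t : n.-tuple R | A (tuple_to_row t)].
Proof.
move=> n0 tA eps e0.
have n2 : 0 < 2 ^+ n :> R by rewrite exprn_gt0.
have [M [c [h [h0 hM hc]]]] := tA _ (divr_gt0 e0 n2).
(* Each ball sits in a cube of side [2 * h], whence the factor [2 ^+ n]; beyond [M] the boxes
   degenerate to the origin, of volume [0] because [0 < n]. *)
exists (fun k i => if (k < M)%N then c k 0 i - h else 0),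
  (fun k i => if (k < M)%N then c k 0 i + h else 0); split; [|split].
- by move=> k i; case: ifP => // _; lra.
- move=> t /hc[k kM hk]; exists k => // i; rewrite kM.
  have := le_trans (coord_le_enorm _ i) hk; rewrite !mxE ler_norml => /andP[h1 h2].
  by apply/andP; split; lra.
move=> N.
have vol k : box_vol (fun i => if (k < M)%N then c k 0 i - h else 0)
    (fun i => if (k < M)%N then c k 0 i + h else 0) = (k < M)%N%:R * (2 * h) ^+ n.
  rewrite /box_vol; case: (k < M)%N.
    rewrite mul1r -[X in _ ^+ X](card_ord n) -prodr_const; apply: eq_bigr => i _; ring.
  rewrite mul0r (eq_bigr (fun=> 0)) => [|i _]; last by rewrite subrr.
  by rewrite prodr_const card_ord expr0n gtn_eqF.
apply: le_trans (_ : M%:R * (2 * h) ^+ n <= _); last first.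
  by rewrite exprMn mulrCA mulrC -ler_pdivlMr.
under eq_bigr do rewrite vol.
rewrite -mulr_suml ler_wpM2r ?exprn_ge0 ?mulr_ge0 // -natr_sum ler_nat.
suff -> : (\sum_(k < N) (k < M))%N = minn N M by rewrite geq_minr.
elim: N => [|N IH]; first by rewrite big_ord0 min0n.
rewrite big_ord_recr /= IH; have [NM|MN] := ltnP N M.
  by rewrite (minn_idPl NM) addn1.
by rewrite (minn_idPr (leqW MN)) addn0.
Qed.

End null_sets.

(** * Orbits converging to the saddle *)

Section saddle.
Context {R : realType} {n : nat}.
Implicit Types (u v w x y z : 'rV[R]_n).

Definition enorm_cvg (u : nat -> 'rV[R]_n) (l : 'rV[R]_n) :=
  forall e : R, 0 < e -> exists N, forall k, (N <= k)%N -> enorm (u k - l) <= e.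

Lemma enorm_cvgP (u : nat -> 'rV[R]_n) (l : 'rV[R]_n) :
  u @ \oo --> l <-> enorm_cvg u l.
Proof.
split.
  move=> /cvgrPdist_le h e e0.
  have n1 : 0 < n%:R + 1 :> R by rewrite ltr_wpDl.
  have [N _ hN] := h _ (divr_gt0 e0 n1).
  exists N => k Nk; have := hN k Nk; rewrite /= distrC ler_pdivlMr // => hk.
  apply: le_trans (enorm_le_mx_norm _) _; apply: le_trans hk.
  by rewrite mulrC ler_wpM2l // lerDl.
move=> h; apply/cvgrPdist_le => e /h[N hN]; exists N => // k Nk.
by rewrite /= distrC; apply: le_trans (mx_norm_le_enorm _) _; exact: hN.
Qed.

Variables (f : 'rV[R]_n -> R) (L alpha : R) (p : nat) (nt : 'I_p -> nat).
Hypothesis sum_nt : (\sum_(t < p) nt t)%N = n.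
Hypothesis C2f : C2 f.
Hypothesis L0 : 0 < L.
Hypothesis lipf : grad_lipschitz f L.
Hypothesis a0 : 0 < alpha.
Hypothesis aL : alpha < L^-1.
Variable xs : 'rV[R]_n.

Local Notation step := (block_step f alpha nt).
Local Notation sweep := (pbcd_sweep f alpha nt).
Local Notation orbit := (pbcd f alpha nt).

Let aL1 : 0 < 1 - alpha * L.
Proof. by rewrite subr_gt0 -ltr_pdivlMr // div1r. Qed.

Lemma pbcd_lipschitz k : exists K : R,
  forall x y, enorm (orbit k x - orbit k y) <= K * enorm (x - y).
Proof.
pose K := (1 - alpha * L)^-1.
have K0 : 0 <= K by rewrite invr_ge0 ltW.
have h1 l x y : enorm (foldl (fun y s => step s y) x l - foldl (fun y s => step s y) y l)
    <= K ^+ size l * enorm (x - y).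
  elim: l x y => [|s l IH] x y /=; first by rewrite expr0 mul1r.
  apply: le_trans (IH _ _) _; rewrite exprSr -mulrA ler_wpM2l ?exprn_ge0 //.
  exact: (block_step_lipschitz nt C2f L0 lipf a0 aL).
exists ((K ^+ size (enum 'I_p)) ^+ k) => x y.
elim: k => [|k IH] /=; first by rewrite expr0 mul1r.
apply: le_trans (h1 (enum 'I_p) _ _) _.
by rewrite exprS -mulrA ler_wpM2l ?exprn_ge0.
Qed.

(** The inverse Lipschitz bound needed to pull thin covers back through the iterates. *)
Lemma pbcd_expansion k : exists2 K : R, 0 < K &
  forall x y, enorm (x - y) <= K * enorm (orbit k x - orbit k y).
Proof.
pose K := 1 + alpha * L.
have K0 : 0 < K by rewrite ltr_wpDr // mulr_ge0 // ltW.
have h1 l x y : enorm (x - y) <=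
    K ^+ size l * enorm (foldl (fun y s => step s y) x l - foldl (fun y s => step s y) y l).
  elim: l x y => [|s l IH] x y /=; first by rewrite expr0 mul1r.
  apply: le_trans (block_step_expansion nt C2f L0 lipf a0 aL s x y) _.
  by rewrite exprS -mulrA ler_wpM2l ?(ltW K0).
exists ((K ^+ size (enum 'I_p)) ^+ k) => [|x y]; first by rewrite !exprn_gt0.
elim: k => [|k IH] /=; first by rewrite expr0 mul1r.
apply: le_trans IH _.
by rewrite exprSr -mulrA ler_wpM2l ?exprn_ge0 ?(ltW K0) // h1.
Qed.

Lemma measurable_pbcd_enorm k (e : R) :
  measurable [set t : n.-tuple R | enorm (orbit k (tuple_to_row t) - xs) <= e].
Proof. by have [K hK] := pbcd_lipschitz k; apply: measurable_enorm_le hK. Qed.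

Lemma measurable_pbcd_cvg :
  measurable [set t : n.-tuple R | enorm_cvg (orbit ^~ (tuple_to_row t)) xs].
Proof.
have -> : [set t : n.-tuple R | enorm_cvg (orbit ^~ (tuple_to_row t)) xs] =
    \bigcap_j \bigcup_N \bigcap_(k in [set k | (N <= k)%N])
      [set t : n.-tuple R | enorm (orbit k (tuple_to_row t) - xs) <= j.+1%:R^-1].
  apply/seteqP; split => t.
    move=> h j _; have j0 : 0 < j.+1%:R^-1 :> R by rewrite invr_gt0.
    by have [N hN] := h _ j0; exists N => // k /= Nk; exact: hN.
  move=> h e e0; have [N _ hN] := h (Num.truncn e^-1) I.
  exists N => k Nk; apply: le_trans (hN k Nk) _.
  by rewrite -[leRHS]invrK lef_pV2 ?posrE ?invr_gt0 // ltW // truncnS_gt.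
apply: bigcapT_measurable => j; apply: bigcup_measurable => N _.
by apply: bigcap_measurableType => k _; exact: measurable_pbcd_enorm.
Qed.

Hypothesis saddle : strict_saddle f xs.

(* Two orbits tending to the saddle cannot differ by a vector of the cone, because
   the quadratic form of their difference would stay away from [0]. *)
Lemma orbits_avoid_cone : exists (S : 'M[R]_n) v0 (rho : R),
  [/\ S^T = S, dotv (v0 *m S) v0 < 0, 0 < rho &
    forall x y, (forall k, enorm (orbit k x - xs) <= rho) ->
      (forall k, enorm (orbit k y - xs) <= rho) ->
      enorm_cvg (orbit ^~ x) xs -> enorm_cvg (orbit ^~ y) xs ->
      x != y -> 0 <= dotv ((x - y) *m S) (x - y)].
Proof.
case: saddle => grad0 [lam [/eigenvalueP[v0 v0H v00] lam0]].
set H := hessian f xs in v0H.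
have HT : H^T = H := hessian_sym xs C2f.
have [K K0 hK] := symmetric_form_le_sq_enorm HT.
pose P := size (enum 'I_p).
have c0 : 0 < alpha^-1 / 2 ^+ P by rewrite divr_gt0 ?invr_gt0 // exprn_gt0.
have C0 : 0 <= alpha^-1 + L by rewrite addr_ge0 ?invr_ge0 // ltW.
have [tau0 tau00 htau] := cone_decrease c0 C0 (ler0n R n) K0.
(* The last two bounds give [tau ^+ 2 < - lam], so that the eigenvector [v0] lies in the open
   cone. *)
pose tau : R := Num.min tau0 (Num.min 1 (- lam / 2)).
have tp : 0 < tau by rewrite !lt_min tau00 ltr01 /= divr_gt0 // oppr_gt0.
have [|eps [eta [eps0 eta0 hdec]]] := htau tau tp; first by rewrite ge_min lexx.
have tl : tau ^+ 2 < - lam.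
  have t1 : tau <= 1 by rewrite !ge_min lexx orbT.
  have t2 : tau <= - lam / 2 by rewrite !ge_min lexx !orbT.
  have : tau ^+ 2 <= tau by rewrite expr2 -[leRHS]mulr1 ler_wpM2l // ltW.
  by move: lam0; lra.
have [r r0 hr] := gradient_strict_derivative xs C2f eps0.
pose Kl := (1 - alpha * L)^-1.
have Kp : 0 < Kl ^+ P by rewrite exprn_gt0 // invr_gt0.
pose S := H + (tau ^+ 2)%:M.
have QE v : dotv (v *m S) v = dotv (v *m H) v + tau ^+ 2 * enorm v ^+ 2.
  by rewrite /S mulmxDr mul_mx_scalar dotvDl dotvZl enorm_sq.
(* Dividing by [Kl ^+ P] keeps the points inside each sweep within [r] of the saddle. *)
exists S, v0, (r / Kl ^+ P); split.
- by rewrite /S linearD /= HT tr_scalar_mx.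
- rewrite QE v0H dotvZl -enorm_sq -mulrDl pmulr_llt0 ?exprn_gt0 ?enorm_gt0 //.
  by move: tl; lra.
- exact: divr_gt0.
move=> x y xr yr xc yc xy; rewrite leNgt; apply/negP => Q0.
pose v k := orbit k x - orbit k y.
pose Q u := dotv (u *m S) u.
have dec k : Q (v k) <= 0 -> Q (v k.+1) <= Q (v k) - eta * enorm (v k) ^+ 2.
  move=> Qk.
  have near z : (forall k, enorm (orbit k z - xs) <= r / Kl ^+ P) ->
      Kl ^+ P * enorm (orbit k z - xs) <= r.
    by move=> /(_ k); rewrite ler_pdivlMr // mulrC.
  have [s [s0 ws qs bs]] := sweep_difference nt C2f L0 lipf a0 aL grad0 eps0 hr
    (near x xr) (near y yr).
  move: ws qs bs; rewrite -/(v k).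
  have -> : foldl (fun y s => step s y) (orbit k x) (enum 'I_p) -
    foldl (fun y s => step s y) (orbit k y) (enum 'I_p) = v k.+1 by [].
  move=> ws qs bs.
  rewrite /Q !QE in Qk *.
  apply: (hdec _ _ s _ _ (enorm (v k *m H))); rewrite ?enorm_ge0 //.
  + have := enormD (v k) (v k.+1 - v k); rewrite (addrC (v k)) subrK => /le_trans; apply.
    by rewrite lerD2l.
  + apply: enorm_le_const => i; have [b ib] := in_block_cover i sum_nt.
    by apply: bs ib; rewrite mem_enum.
  + by apply: le_trans (hK _); rewrite -normrN ler_norm.
have vpos : 0 < enorm (v 0%N) by rewrite enorm_gt0 // subr_eq0.
(* The first sweep lowers [Q] by at least [m], and later ones never raise it. *)
pose m := eta * enorm (v 0%N) ^+ 2.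
have m0 : 0 < m by rewrite mulr_gt0 // exprn_gt0.
have neg k : Q (v k.+1) <= - m.
  elim: k => [|k IH].
    by apply: le_trans (dec 0%N (ltW Q0)) _; rewrite -/m; move: (ltW Q0); rewrite -/(Q _) /v /=; lra.
  have Qk : Q (v k.+1) <= 0 by apply: le_trans IH _; rewrite oppr_le0 ltW.
  apply: le_trans (dec _ Qk) _; apply: le_trans IH.
  by rewrite lerBlDr lerDl mulr_ge0 ?exprn_ge0 ?enorm_ge0 // ltW.
(* Once both orbits are within [e], the form is at least [- L * (2 * e) ^+ 2 >= - m / 2],
   contradicting [Q <= - m]. *)
pose e := Num.min 1 (m / (8 * L)).
have e0 : 0 < e by rewrite lt_min ltr01 divr_gt0 // mulr_gt0.
have [N1 h1] := xc _ e0; have [N2 h2] := yc _ e0.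
pose k := maxn N1 N2.
have vk : enorm (v k.+1) <= 2 * e.
  have -> : v k.+1 = (orbit k.+1 x - xs) - (orbit k.+1 y - xs) by rewrite opprB addrA subrK.
  apply: le_trans (enormB _ _) _; rewrite mulr_natl mulr2n; apply: lerD.
    by apply: h1; rewrite leqW // leq_maxl.
  by apply: h2; rewrite leqW // leq_maxr.
have q1 : `|dotv (v k.+1 *m H) (v k.+1)| <= L * enorm (v k.+1) ^+ 2.
  apply: le_trans (dotv_abs_le _ _) _.
  by rewrite expr2 mulrA ler_wpM2r ?enorm_ge0 // hessian_le_lipschitz.
have q2 : L * enorm (v k.+1) ^+ 2 <= m / 2.
  have e1 : e <= 1 by rewrite ge_min lexx.
  have e2 : e * (8 * L) <= m by rewrite -ler_pdivlMr ?mulr_gt0 // ge_min lexx orbT.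
  have : enorm (v k.+1) ^+ 2 <= (2 * e) ^+ 2.
    by rewrite ler_pXn2r ?nnegrE ?enorm_ge0 // mulr_ge0 // ltW.
  have ee : e ^+ 2 <= e by rewrite expr2 -[leRHS]mulr1 ler_wpM2l // ltW.
  move=> hv; apply: le_trans (_ : L * (4 * e) <= _); last by lra.
  by rewrite ler_wpM2l ?(ltW L0) //; apply: le_trans hv _; rewrite exprMn; lra.
have q3 : 0 <= tau ^+ 2 * enorm (v k.+1) ^+ 2 by rewrite mulr_ge0 ?sqr_ge0.
have := neg k; rewrite /Q QE; move: q1; rewrite ler_norml => /andP[q1 _].
by move: m0; lra.
Qed.

End saddle.

(** * Countable exhaustion of the convergent orbits *)

Theorem theorem6 (R : realType) (n p : nat) (nt : 'I_p -> nat)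
    (f : 'rV[R]_n -> R) (L alpha : R) (xstar : 'rV[R]_n)
    (nu : probability (n.-tuple R) R) :
  (forall t, 0 < nt t)%N ->
  (\sum_(t < p) nt t)%N = n ->
  C2 f -> 0 < L -> grad_lipschitz f L ->
  strict_saddle f xstar ->
  0 < alpha -> alpha < L^-1 ->
  abs_cont_lebesgue nu ->
  nu [set t | pbcd f alpha nt k (tuple_to_row t) @[k --> \oo] --> xstar] = 0%E.
Proof.
move=> _ sum_nt C2f L0 lipf saddle a0 aL ac.
have n0 : (0 < n)%N.
  case: saddle => _ [lam [/eigenvalueP[v _ v0] _]]; case: (posnP n) => // n_eq0.
  by move: v v0; rewrite n_eq0 => v; rewrite thinmx0 eqxx.
have [S [v0 [rho [Ss v0neg rho0 avoid]]]] :=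
  orbits_avoid_cone sum_nt C2f L0 lipf a0 aL saddle.
pose orbit := pbcd f alpha nt.
pose cv x := enorm_cvg (orbit ^~ x) xstar.
pose loc := [set x | cv x /\ forall k, enorm (orbit k x - xstar) <= rho].
(* Convergent orbits that stay within [rho] from time [m] on: a measurable set, as absolute
   continuity requires, mapped into [loc] by the [m]-th iterate. *)
pose W m := [set t : n.-tuple R | cv (tuple_to_row t)] `&`
  \bigcap_(k in [set k | (m <= k)%N])
    [set t : n.-tuple R | enorm (orbit k (tuple_to_row t) - xstar) <= rho].
have mcv : measurable [set t : n.-tuple R | cv (tuple_to_row t)].
  exact: (measurable_pbcd_cvg nt C2f L0 lipf a0 aL xstar).
have mW m : measurable (W m).
  apply: measurableI => //; apply: bigcap_measurableType => k _.
  exact: (measurable_pbcd_enorm nt C2f L0 lipf a0 aL xstar).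
have tloc : thin loc.
  apply: (@cone_free_thin _ _ S v0 (rho + enorm xstar)) => //.
    move=> x [_ /(_ 0%N) /= h]; rewrite -[x](subrK xstar).
    by apply: le_trans (enormD _ _) _; rewrite lerD2r.
  by move=> x y [xc xr] [yc yr]; exact: avoid.
have nW m : nu (W m) = 0%E.
  apply: ac => // eps e0.
  have [K K0 hK] := pbcd_expansion nt C2f L0 lipf a0 aL m.
  have [a [b [ab [sub vol]]]] :=
    thin_lebesgue_null n0 (thin_preimage K0 hK tloc) e0.
  exists a, b; split => //; split => // t [tc tr]; apply: sub.
  have shift k : orbit k (orbit m (tuple_to_row t)) = orbit (k + m)%N (tuple_to_row t).
    by rewrite /orbit /pbcd iterD.
  split => [e /tc[N hN]|k]; last by rewrite -/orbit shift; apply: tr; rewrite /= leq_addl.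
  by exists N => k Nk; rewrite shift; apply: hN; rewrite (leq_trans Nk) // leq_addr.
have -> : [set t | pbcd f alpha nt k (tuple_to_row t) @[k --> \oo] --> xstar] = \bigcup_m W m.
  apply/seteqP; split => t /=.
    move=> /enorm_cvgP tc; have [N hN] := tc _ rho0.
    by exists N => //; split => // k Nk; exact: hN.
  by move=> [m _ [tc _]]; apply/enorm_cvgP.
apply: measure_negligible; first exact: bigcupT_measurable.
by apply: negligible_bigcup => m; exists (W m); split; [exact: mW|exact: nW|].
Qed.
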